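(* Let $M_0, M_1, \ldots$ be linear orders each equal to $\omega$ or $\omega^*$ which alternate, and likewise $N_0, N_1, \ldots$, with $M_0 = \omega$ if and only if $N_0 = \omega^*$. Let $s,t,u,v \ge 1$ and let all exponents below be non-zero natural numbers. Put $A_1 = M_0^{m_0} \cdots M_{s-1}^{m_{s-1}}$, $A_2 = N_0^{n_0} \cdots N_{t-1}^{n_{t-1}}$, $B_1 = M_0^{p_0} \cdots M_{u-1}^{p_{u-1}}$, $B_2 = N_0^{q_0} \cdots N_{v-1}^{q_{v-1}}$, and $A = A_1 + A_2$, $B = B_1 + B_2$. Then $l(A,B) = \min(l(A_1,B_1), l(A_2,B_2))$, except when $M_0 = \omega^*$ and one of the following holds: (a) $s = u = 1$, $t, v \ge 2$, $\min(m_0,p_0) = 1$ and $m_0 \neq p_0$; (b) $t = v = 1$, $s,u \ge 2$, $\min(n_0,q_0) = 1$ and $n_0 \neq q_0$; (c) $s = 1$, $u \ge 2$, and either $t \ge 2$ or ($t = 1$ and $m_0 \ge 2$); (d) $u = 1$, $s \ge 2$, and either $v \ge 2$ or ($v = 1$ and $p_0 \ge 2$); (e) $t = 1$, $v \ge 2$, and either $s \ge 2$ or ($s = 1$ and $n_0 \ge 2$); (f) $v = 1$, $t \ge 2$, and either $u \ge 2$ or ($u = 1$ and $q_0 \ge 2$); in which cases $l(A,B) = 3$; or (g) $s = 1$, $u \ge 2$, $t = m_0 = 1$; (h) $u = 1$, $s \ge 2$, $v = p_0 = 1$; (i) $t = 1$, $v \ge 2$, $s = n_0 = 1$; (j) $v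 = 1$, $t \ge 2$, $u = q_0 = 1$; in which cases $l(A,B) = 2$.
   Context: $\omega^*$ is the reverse of $\omega$. For linear orders $X, Y$: $X + Y$ is the concatenation ($X$ followed by $Y$); $X \cdot Y$ is the anti-lexicographic product (''$Y$ copies of $X$''): pairs $(x,y)$ compared first by $y$, then by $x$; $M^n$ is the product of $n$ copies of $M$. For $n \ge 1$, $X \equiv_n Y$ means player II has a winning strategy in the $n$-move Ehrenfeucht–Fraïssé game on $X$ and $Y$ (each move: I picks an element of either structure, II an element of the other; II wins if the correspondence between chosen elements is an order-isomorphism of the induced substructures). $l(X,Y)$ is the non-zero natural number $n$ with $X \equiv_n Y$ and $X \not\equiv_{n+1} Y$, and $l(X,Y) = \infty$ if $X \equiv_n Y$ for all $n$.
   Formalization: Clauses (c)-(j) are corrected: the tests on m_0 or n_0 in (c),(e),(g),(i) become tests on min(m_0,n_0), those on p_0 or q_0 in (d),(f),(h),(j) on min(p_0,q_0); as stated they conflict, and (c) gives 3 for (ω* )^2+ω and ω*·ω+ω, where l = 2. *)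

(* Defs.v *)
From HB Require Import structures.
From mathcomp Require Import all_boot all_order.
From mathcomp Require Import boolp classical_sets.

Set Implicit Arguments.
Unset Strict Implicit.
Unset Printing Implicit Defensive.

Import Order.TTheory.

(* [orderType] is indexed by a display, which differs between an order and the
   orders built from it; the display is packed here so that sums and products of
   linear orders are again of the same type. *)
Record linorder := LinOrder {
  lin_disp : Order.disp_t;
  lin_sort :> orderType lin_disp
}.

Definition omega : linorder := LinOrder nat.

Definition omega_star : linorder := LinOrder (nat^d)%type.

Section SumOrder.
Context (d1 d2 : Order.disp_t) (X : orderType d1) (Y : orderType d2).

Definition sum_le (a b : X + Y) : bool :=
  match a, b with
  | inl x, inl x' => (x <= x')%O
  | inl _, inr _ => true
  | inr _, inl _ => false
  | inr y, inr y' => (y <= y')%O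
  end.

Fact sum_le_refl : reflexive sum_le.
Proof. by case=> z /=; exact: lexx. Qed.

Fact sum_le_anti : antisymmetric sum_le.
Proof. by case=> [a|a] [b|b] //= /le_anti ->. Qed.

Fact sum_le_trans : transitive sum_le.
Proof. by case=> [a|a] [b|b] [c|c] //=; exact: le_trans. Qed.

Fact sum_le_total : total sum_le.
Proof. by case=> [a|a] [b|b] //=; exact: le_total. Qed.

Fact sum_display : Order.disp_t. Proof. exact: Order.Disp tt tt. Qed.

HB.instance Definition _ := Order.Le_isPOrder.Build sum_display (X + Y)%type
  sum_le_refl sum_le_anti sum_le_trans.

HB.instance Definition _ :=
  Order.POrder_isTotal.Build sum_display (X + Y)%type sum_le_total.

End SumOrder.

Definition lin_add (X Y : linorder) : linorder := LinOrder (X + Y)%type.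

(* [Y *l X] is lexicographic with the [Y]-component most significant: the pair
   $(x, y)$ of the anti-lexicographic product $X \cdot Y$ is stored as
   [(y, x)]. *)
Definition lin_mul (X Y : linorder) : linorder := LinOrder (Y *l X)%type.

Definition lin_one : linorder := LinOrder 'I_1.

Definition lin_prod (s : seq linorder) : linorder :=
  if s is X :: s' then foldl lin_mul X s' else lin_one.

Definition lin_pow (X : linorder) (n : nat) : linorder := lin_prod (nseq n X).

(* $M_0^{e_0} \cdots M_{k-1}^{e_{k-1}}$ *)
Definition pow_prod (M : nat -> linorder) (e : nat -> nat) (k : nat) : linorder :=
  lin_prod [seq lin_pow (M i) (e i) | i <- iota 0 k].

Definition alternating (M : nat -> linorder) : Prop :=
  (forall i, M i = omega \/ M i = omega_star) /\ (forall i, M i.+1 <> M i).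

Section Game.
Context (X Y : linorder).

(* A move of player I is an element of [X + Y]. The first argument of each
   answer function is the sequence of all earlier moves of player I. *)
Record strategy := Strategy {
  answerY : seq (X + Y) -> X -> Y;
  answerX : seq (X + Y) -> Y -> X
}.

Fixpoint play (sigma : strategy) (past moves : seq (X + Y)) : seq (X * Y) :=
  match moves with
  | [::] => [::]
  | inl x :: rest =>
      (x, answerY sigma past x) :: play sigma (rcons past (inl x)) rest
  | inr y :: rest =>
      (answerX sigma past y, y) :: play sigma (rcons past (inr y)) rest
  end.

(* By antisymmetry this also says that the correspondence is single-valued and
   injective. *)
Definition order_correspondence (s : seq (X * Y)) : Prop :=
  {in s &, forall a b, (a.1 <= b.1)%O = (a.2 <= b.2)%O}.

Definition ef_equiv (n : nat) : Prop :=
  exists sigma : strategy, forall moves : seq (X + Y),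
    size moves = n -> order_correspondence (play sigma [::] moves).

(* [None] stands for $\infty$. *)
Definition ef_length : option nat :=
  if `[< forall n, 0 < n -> ef_equiv n >] then None
  else Some (xget 0 [set n | [/\ 0 < n, ef_equiv n & ~ ef_equiv n.+1]]%classic).

End Game.

Definition ext_min (a b : option nat) : option nat :=
  match a, b with
  | Some i, Some j => Some (minn i j)
  | Some i, None => Some i
  | None, _ => b
  end.

(* A clause that splits on $s = t = 1$ tests [minn m0 n0], and one that splits on
   $u = v = 1$ tests [minn p0 q0]: such a value is decided by both summands. As
   published, the theorem tests one of the two exponents only ($m_0$ or $n_0$,
   resp. $p_0$ or $q_0$). The set of exceptional cases is the same, but in that
   form the clauses for 3 and for 2 overlap (e.g. for $s = t = 1$,
   $u = v = 2$, $m_0 = 2$, $n_0 = 1$), and some clauses for 3 fail: for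
   $A = \omega^* \cdot \omega^* + \omega$ and
   $B = \omega^* \cdot \omega + \omega$ one has $l(A,B) = 2$, since $B$ has an
   element without immediate predecessor and $A$ has none. *)
Definition exceptional3 (s t u v m0 n0 p0 q0 : nat) : Prop :=
  [/\ s = 1 /\ u = 1, 2 <= t /\ 2 <= v, minn m0 p0 = 1 & m0 <> p0] \/
  [/\ t = 1 /\ v = 1, 2 <= s /\ 2 <= u, minn n0 q0 = 1 & n0 <> q0] \/
  [/\ s = 1, 2 <= u & 2 <= t \/ (t = 1 /\ 2 <= minn m0 n0)] \/
  [/\ u = 1, 2 <= s & 2 <= v \/ (v = 1 /\ 2 <= minn p0 q0)] \/
  [/\ t = 1, 2 <= v & 2 <= s \/ (s = 1 /\ 2 <= minn m0 n0)] \/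
  [/\ v = 1, 2 <= t & 2 <= u \/ (u = 1 /\ 2 <= minn p0 q0)].

Definition exceptional2 (s t u v m0 n0 p0 q0 : nat) : Prop :=
  [/\ s = 1, 2 <= u, t = 1 & minn m0 n0 = 1] \/
  [/\ u = 1, 2 <= s, v = 1 & minn p0 q0 = 1] \/
  [/\ t = 1, 2 <= v, s = 1 & minn m0 n0 = 1] \/
  [/\ v = 1, 2 <= t, u = 1 & minn p0 q0 = 1].

(* Main.v *)
(* Call a point of an order a limit if the points below it form a non-empty set
   without greatest element. This needs two further moves to express, so
   $X \equiv_{n+2} X'$ implies that the sets of limits are $\equiv_n$. The limits of
   $\omega \cdot Y$ form a copy of $Y$ minus its least element (if any), and
   conversely the $n$-equivalence of these sets, together with the agreement on
   the existence of a least element, gives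
   $\omega \cdot Y \equiv_{n+2} \omega \cdot Y'$.

   If $M_0 = \omega$, then $A = \omega \cdot X + \omega^* \cdot Y$ and its limits are
   those of the first summand, so $A \equiv_n B$ passes to the first summands and,
   by reversal, to the second ones. If $M_0 = \omega^*$, then
   $A = \omega^* \cdot X + \omega \cdot Y$, and the least point of the second summand
   is a limit of $A$ exactly when the first summand has no greatest element. This
   is the only obstruction, it concerns only $s$, $t$ being 1 or not and the first
   exponents, and it produces the exceptional cases. There $A$ has no endpoints, so
   $A \equiv_2 B$, and $A \equiv_3 B$ only depends on whether $A$ and $B$ have limits
   and limits of the reverse order. *)

Require Import Defs.
From mathcomp Require Import all_boot all_order.
From mathcomp Require Import boolp classical_sets.
From mathcomp Require Import zify.

Set Implicit Arguments.
Unset Strict Implicit.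
Unset Printing Implicit Defensive.

Import Order.TTheory.
Local Open Scope classical_set_scope.
Local Open Scope order_scope.

(** * Back-and-forth equivalence between subsets of linear orders *)

Definition below (X : linorder) (P : set X) (x : X) : set X :=
  [set z | P z /\ z < x].

Definition above (X : linorder) (P : set X) (x : X) : set X :=
  [set z | P z /\ x < z].

(* Once $x$ and $y$ have been chosen, the remaining game splits into independent
   games on the two sides of these points. *)
Fixpoint bf (X Y : linorder) (n : nat) (P : set X) (Q : set Y) : Prop :=
  if n is n'.+1 then
    (forall x, P x -> exists2 y, Q y &
       bf n' (below P x) (below Q y) /\ bf n' (above P x) (above Q y)) /\
    (forall y, Q y -> exists2 x, P x &
       bf n' (below P x) (below Q y) /\ bf n' (above P x) (above Q y))
  else True.

Arguments bf : simpl never.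

Definition bf_equiv (n : nat) (X Y : linorder) : Prop :=
  bf n [set: X] [set: Y].

Section Bf.
Implicit Types X Y Z : linorder.

Lemma bf_sym n X Y (P : set X) (Q : set Y) : bf n P Q -> bf n Q P.
Proof.
elim: n P Q => //= n IHn P Q [PQ QP]; split=> [y /QP|x /PQ] [z Rz [/IHn b /IHn a]];
  by exists z.
Qed.

Lemma bfW n X Y (P : set X) (Q : set Y) : bf n.+1 P Q -> bf n P Q.
Proof.
elim: n P Q => // n IHn P Q [PQ QP].
by split=> [x /PQ|y /QP] [z Rz [/IHn b /IHn a]]; exists z.
Qed.

Lemma bf_leq m n X Y (P : set X) (Q : set Y) :
  (m <= n)%N -> bf n P Q -> bf m P Q.
Proof.
move=> /subnK <-; elim: (n - m)%N => // k IHk h; apply: IHk; exact: bfW.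
Qed.

Lemma bf_trans n X Y Z (P : set X) (Q : set Y) (R : set Z) :
  bf n P Q -> bf n Q R -> bf n P R.
Proof.
elim: n X Y Z P Q R => // n IHn X Y Z P Q R [PQ QP] [QR RQ]; split=> [x|z].
- move=> /PQ[y Qy [b a]]; have [z Rz [b' a']] := QR _ Qy.
  by exists z => //; split; [exact: IHn b b'|exact: IHn a a'].
- move=> /RQ[y Qy [b a]]; have [x Px [b' a']] := QP _ Qy.
  by exists x => //; split; [exact: IHn b' b|exact: IHn a' a].
Qed.

Lemma bf_iso n X Y (P : set X) (Q : set Y) (f : X -> Y) :
  (forall x, P x -> Q (f x)) -> (forall y, Q y -> exists2 x, P x & f x = y) ->
  {in P &, {mono f : x y / x < y}} -> bf n P Q.
Proof.
elim: n P Q => // n IHn P Q fPQ fQP fm.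
have key x : P x -> bf n (below P x) (below Q (f x)) /\
                    bf n (above P x) (above Q (f x)).
  move=> Px; split; apply: IHn.
  - by move=> z [Pz zx]; split; [exact: fPQ|rewrite fm ?inE].
  - by move=> _ [/fQP[z Pz <-]]; rewrite fm ?inE //; exists z.
  - by move=> y z /set_mem[Py _] /set_mem[Pz _]; apply: fm; rewrite inE.
  - by move=> z [Pz zx]; split; [exact: fPQ|rewrite fm ?inE].
  - by move=> _ [/fQP[z Pz <-]]; rewrite fm ?inE //; exists z.
  - by move=> y z /set_mem[Py _] /set_mem[Pz _]; apply: fm; rewrite inE.
split=> [x Px|_ /fQP[x Px <-]].
- by exists (f x); [exact: fPQ|exact: key].
- by exists x => //; exact: key.
Qed.

Lemma bf_refl n X (P : set X) : bf n P P.
Proof. by apply: (@bf_iso _ _ _ _ _ id) => // x Px; exists x. Qed.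

Lemma below_below X (P : set X) x z :
  z < x -> below (below P x) z = below P z.
Proof.
move=> zx; apply/seteqP; split=> w; first by case=> -[].
by case=> Pw wz; do 2!split=> //; exact: lt_trans wz zx.
Qed.

(** A move in one part is answered in the same part. The other part lies entirely on one side of
    both points and keeps its old level of equivalence, so [bfW] and the induction glue it to that
    side. *)
Lemma bf_cat n X Y (P1 P2 : set X) (Q1 Q2 : set Y) :
  (forall x1 x2, P1 x1 -> P2 x2 -> x1 < x2) ->
  (forall y1 y2, Q1 y1 -> Q2 y2 -> y1 < y2) ->
  bf n P1 Q1 -> bf n P2 Q2 -> bf n (P1 `|` P2) (Q1 `|` Q2).
Proof.
elim: n P1 P2 Q1 Q2 => // n IHn P1 P2 Q1 Q2 P12 Q12 b1 b2.
have belowl Z (R1 R2 : set Z) z : (forall x1 x2, R1 x1 -> R2 x2 -> x1 < x2) ->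
    R1 z -> below (R1 `|` R2) z = below R1 z.
  move=> R12 R1z; apply/seteqP; split=> w [Rw wz]; split=> //; last by left.
  by case: Rw => // /(R12 _ _ R1z)/(lt_trans wz); rewrite ltxx.
have belowr Z (R1 R2 : set Z) z : (forall x1 x2, R1 x1 -> R2 x2 -> x1 < x2) ->
    R2 z -> below (R1 `|` R2) z = R1 `|` below R2 z.
  move=> R12 R2z; apply/seteqP; split=> w.
    by case=> -[R1w wz|R2w wz]; [left|right].
  by case=> [R1w|[R2w wz]]; [split; [left|exact: R12]|split; [right|]].
have abovel Z (R1 R2 : set Z) z : (forall x1 x2, R1 x1 -> R2 x2 -> x1 < x2) ->
    R1 z -> above (R1 `|` R2) z = above R1 z `|` R2.
  move=> R12 R1z; apply/seteqP; split=> w.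
    by case=> -[R1w wz|R2w wz]; [left|right].
  by case=> [[R1w wz]|R2w]; [split; [left|]|split; [right|exact: R12]].
have abover Z (R1 R2 : set Z) z : (forall x1 x2, R1 x1 -> R2 x2 -> x1 < x2) ->
    R2 z -> above (R1 `|` R2) z = above R2 z.
  move=> R12 R2z; apply/seteqP; split=> w [Rw wz]; split=> //; last by right.
  by case: Rw => // /R12/(_ R2z)/(lt_trans wz); rewrite ltxx.
have keyl x y : P1 x -> Q1 y -> bf n (below P1 x) (below Q1 y) ->
    bf n (above P1 x) (above Q1 y) ->
    bf n (below (P1 `|` P2) x) (below (Q1 `|` Q2) y) /\
    bf n (above (P1 `|` P2) x) (above (Q1 `|` Q2) y).
  move=> Px Qy b a; rewrite !belowl // !abovel //; split=> //.
  apply: IHn => //; last exact: bfW.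
  - by move=> x1 x2 [+ _]; exact: P12.
  - by move=> x1 x2 [+ _]; exact: Q12.
have keyr x y : P2 x -> Q2 y -> bf n (below P2 x) (below Q2 y) ->
    bf n (above P2 x) (above Q2 y) ->
    bf n (below (P1 `|` P2) x) (below (Q1 `|` Q2) y) /\
    bf n (above (P1 `|` P2) x) (above (Q1 `|` Q2) y).
  move=> Px Qy b a; rewrite !belowr // !abover //; split=> //.
  apply: IHn => //; last exact: bfW.
  - by move=> x1 x2 + [+ _]; exact: P12.
  - by move=> x1 x2 + [+ _]; exact: Q12.
case: b1 b2 => [PQ1 QP1] [PQ2 QP2]; split.
- move=> x [Px|Px].
    by have [y Qy [b a]] := PQ1 _ Px; exists y; [left|exact: keyl].
  by have [y Qy [b a]] := PQ2 _ Px; exists y; [right|exact: keyr].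
- move=> y [Qy|Qy].
    by have [x Px [b a]] := QP1 _ Qy; exists x; [left|exact: keyl].
  by have [x Px [b a]] := QP2 _ Qy; exists x; [right|exact: keyr].
Qed.

Lemma bf1P X Y (P : set X) (Q : set Y) : bf 1 P Q <-> (P !=set0 <-> Q !=set0).
Proof.
split=> [[PQ QP]|PQ].
  by split=> -[z] => [/PQ|/QP] [w]; exists w.
split=> [x Px|y Qy].
  by have [y Qy] := PQ.1 (ex_intro _ x Px); exists y.
by have [x Px] := PQ.2 (ex_intro _ y Qy); exists x.
Qed.

Definition min_in X (P : set X) := exists2 x, P x & forall z, P z -> x <= z.

Definition max_in X (P : set X) := exists2 x, P x & forall z, P z -> z <= x.

Lemma below_nonempty X (P : set X) x :
  below P x !=set0 <-> ~ forall z, P z -> x <= z.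
Proof.
split=> [[z [Pz zx]] /(_ z Pz)|]; first by rewrite leNgt zx.
move=> /existsNP[z /not_implyP[Pz /negP]]; rewrite -ltNge => zx.
by exists z.
Qed.

Lemma above_nonempty X (P : set X) x :
  above P x !=set0 <-> ~ forall z, P z -> z <= x.
Proof.
split=> [[z [Pz zx]] /(_ z Pz)|]; first by rewrite leNgt zx.
move=> /existsNP[z /not_implyP[Pz /negP]]; rewrite -ltNge => zx.
by exists z.
Qed.

(** One move picks the least element; a second one would reveal a point below the answer. *)
Lemma bf2_min_in X Y (P : set X) (Q : set Y) : bf 2 P Q -> min_in P -> min_in Q.
Proof.
move=> [PQ _] [x /PQ[y Qy [/bf1P b _]] xmin]; exists y => //.
by apply: contrapT => /below_nonempty/b/below_nonempty; apply.
Qed.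

Lemma bf2_max_in X Y (P : set X) (Q : set Y) : bf 2 P Q -> max_in P -> max_in Q.
Proof.
move=> [PQ _] [x /PQ[y Qy [_ /bf1P b]] xmin]; exists y => //.
by apply: contrapT => /above_nonempty/b/above_nonempty; apply.
Qed.

Definition inner X (P : set X) (x : X) :=
  [/\ P x, below P x !=set0 & above P x !=set0].

Lemma above_least X (P : set X) x x0 :
  inner P x0 -> (forall z, P z -> x <= z) -> above P x !=set0.
Proof.
move=> [Px0 [z [Pz zx0]] _] xmin; exists x0; split=> //.
exact: le_lt_trans (xmin _ Pz) zx0.
Qed.

Lemma below_greatest X (P : set X) x x0 :
  inner P x0 -> (forall z, P z -> z <= x) -> below P x !=set0.
Proof.
move=> [Px0 _ [z [Pz zx0]]] xmax; exists x0; split=> //.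
exact: lt_le_trans zx0 (xmax _ Pz).
Qed.

(** After the first move only the emptiness of the two sides matters, so a point counts only as
    least, greatest or inner. The inner points also ensure that no point is both least and
    greatest. *)
Lemma bf2 X Y (P : set X) (Q : set Y) : (min_in P <-> min_in Q) ->
  (max_in P <-> max_in Q) -> (exists x, inner P x) -> (exists y, inner Q y) ->
  bf 2 P Q.
Proof.
have half X' Y' (R : set X') (S : set Y') : (min_in R -> min_in S) ->
    (max_in R -> max_in S) -> (exists x, inner R x) -> (exists y, inner S y) ->
    forall x, R x -> exists2 y, S y &
      bf 1 (below R x) (below S y) /\ bf 1 (above R x) (above S y).
  move=> mi ma [x0 inx] [y0 iny] x Rx.
  have [bx|/below_nonempty/contrapT xmin] := pselect (below R x !=set0); last first.
    have [|y Sy ymin] := mi; first by exists x.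
    exists y => //; split; apply/bf1P; split.
    - by move=> /below_nonempty.
    - by move=> /below_nonempty.
    - by move=> _; exact: above_least iny ymin.
    - by move=> _; exact: above_least inx xmin.
  have [ax|/above_nonempty/contrapT xmax] := pselect (above R x !=set0); last first.
    have [|y Sy ymax] := ma; first by exists x.
    exists y => //; split; apply/bf1P; split.
    - by move=> _; exact: below_greatest iny ymax.
    - by [].
    - by move=> /above_nonempty.
    - by move=> /above_nonempty.
  by case: iny => Sy0 by0 ay0; exists y0 => //; split; apply/bf1P.
move=> mi ma iP iQ; split; first exact: half mi.1 ma.1 iP iQ.
move=> y Qy; have [x Px [b a]] := half _ _ _ _ mi.2 ma.2 iQ iP y Qy.
by exists x => //; split; exact: bf_sym.
Qed.

(** Player I takes [x], which has nothing on either side, whereas two distinct points of [Q] leave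
    something beside any answer. *)
Lemma not_bf2_set1 X Y (x : X) (Q : set Y) y z :
  Q y -> Q z -> y != z -> ~ bf 2 [set x] Q.
Proof.
move=> Qy Qz yz [+ _] => /(_ x erefl)[w Qw [/bf1P b /bf1P a]].
have aE v : Q v -> v = w.
  move=> Qv; have [vw|vw|//] := ltgtP v w.
    by have [|u [/= ->]] := b.2; [exists v|rewrite ltxx].
  by have [|u [/= ->]] := a.2; [exists v|rewrite ltxx].
by move: yz; rewrite (aE _ Qy) (aE _ Qz) eqxx.
Qed.

End Bf.

(** * Strategies *)

Section Game.
Variables X Y : linorder.
Implicit Types (s : seq (X * Y)) (P : set X) (Q : set Y).

(** The game in terms of positions: [s] lists the pairs chosen so far, while [P] and [Q] confine
    only the moves to come. It mediates between [bf], which forgets the past, and strategies, which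
    are functions of it. *)
Fixpoint wins (n : nat) P Q s : Prop :=
  order_correspondence s /\
  if n is n'.+1 then
    (forall x, P x -> exists2 y, Q y & wins n' P Q ((x, y) :: s)) /\
    (forall y, Q y -> exists2 x, P x & wins n' P Q ((x, y) :: s))
  else True.

Lemma wins_corr n P Q s : wins n P Q s -> order_correspondence s.
Proof. by case: n => [|n] []. Qed.

Lemma winsW n P Q s : wins n.+1 P Q s -> wins n P Q s.
Proof.
elim: n s => [|n IHn] s [oc [PQ QP]]; first by [].
by split=> //; split=> [x /PQ|y /QP] [z Rz /IHn]; exists z.
Qed.

Lemma sub_order_correspondence s s' : {subset s <= s'} ->
  order_correspondence s' -> order_correspondence s.
Proof. by move=> ss' oc a b /ss' + /ss'; exact: oc. Qed.

Lemma order_correspondence_cat x y s1 s2 :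
  order_correspondence s1 -> order_correspondence s2 ->
  {in s1, forall a, a.1 < x /\ a.2 < y} ->
  {in s2, forall a, x < a.1 /\ y < a.2} ->
  order_correspondence ((x, y) :: s1 ++ s2).
Proof.
move=> oc1 oc2 lt1 lt2 a b; rewrite !inE !mem_cat.
move=> /or3P[/eqP->|a1|a2] /or3P[/eqP->|b1|b2] /=.
- by rewrite !lexx.
- by have [b1x b2y] := lt1 _ b1; rewrite !leNgt b1x b2y.
- by have [b1x b2y] := lt2 _ b2; rewrite !ltW.
- by have [a1x a2y] := lt1 _ a1; rewrite !ltW.
- exact: oc1.
- have [a1x a2y] := lt1 _ a1; have [b1x b2y] := lt2 _ b2.
  by rewrite !ltW ?(lt_trans a1x b1x) ?(lt_trans a2y b2y).
- by have [a1x a2y] := lt2 _ a2; rewrite !leNgt a1x a2y.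
- have [b1x b2y] := lt1 _ b1; have [a1x a2y] := lt2 _ a2.
  by rewrite !leNgt (lt_trans b1x a1x) (lt_trans b2y a2y).
- exact: oc2.
Qed.

(** Player II plays separately on the two sides of [(x, y)]. Only membership in [s] matters, because
    new pairs are not added in the order of the concatenation. *)
Lemma wins_cat n P Q x y s1 s2 s : P x -> Q y ->
  wins n (below P x) (below Q y) s1 -> wins n (above P x) (above Q y) s2 ->
  {in s1, forall a, a.1 < x /\ a.2 < y} ->
  {in s2, forall a, x < a.1 /\ y < a.2} ->
  s =i (x, y) :: s1 ++ s2 -> wins n P Q s.
Proof.
move=> Px Qy; elim: n s1 s2 s => [|n IHn] s1 s2 s w1 w2 lt1 lt2 ss;
  (split; first by apply: (@sub_order_correspondence _ ((x, y) :: s1 ++ s2));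
    [move=> a; rewrite ss|apply: order_correspondence_cat lt1 lt2;
      [exact: wins_corr w1|exact: wins_corr w2]]) => //.
have keyl x' y' : below P x x' -> below Q y y' ->
    wins n (below P x) (below Q y) ((x', y') :: s1) -> wins n P Q ((x', y') :: s).
  move=> [_ x'x] [_ y'y] w1'; apply: (IHn _ s2) w1' _ _ lt2 _.
  - exact: winsW.
  - by move=> a; rewrite inE => /predU1P[->//|]; exact: lt1.
  - by move=> a; rewrite !(inE, mem_cat) ss !(inE, mem_cat) orbCA.
have keyr x' y' : above P x x' -> above Q y y' ->
    wins n (above P x) (above Q y) ((x', y') :: s2) -> wins n P Q ((x', y') :: s).
  move=> [_ x'x] [_ y'y] w2'; apply: (IHn s1 _) w2' lt1 _ _.
  - exact: winsW.
  - by move=> a; rewrite inE => /predU1P[->//|]; exact: lt2.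
  - move=> a; rewrite !(inE, mem_cat) ss !(inE, mem_cat) orbCA.
    by congr (_ || _); rewrite orbCA.
(* Player I may choose [x] or [y] again, which belong to neither side; the pair [(x, y)] is then
   repeated. *)
have key0 : wins n P Q ((x, y) :: s).
  apply: (IHn s1 s2) => //; [exact: winsW|exact: winsW|].
  by move=> a; rewrite inE ss inE orbA orbb.
move: (w1) (w2) => [_ [PQ1 QP1]] [_ [PQ2 QP2]].
split=> [x' Px'|y' Qy'].
- have [x'x|x'x|->] := ltgtP x' x; last by exists y.
  + have [//|y' Qy' w] := PQ1 x'; exists y'; first by case: Qy'.
    exact: keyl.
  + have [//|y' Qy' w] := PQ2 x'; exists y'; first by case: Qy'.
    exact: keyr.
- have [y'y|y'y|->] := ltgtP y' y; last by exists x.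
  + have [//|x' Px' w] := QP1 y'; exists x'; first by case: Px'.
    exact: keyl.
  + have [//|x' Px' w] := QP2 y'; exists x'; first by case: Px'.
    exact: keyr.
Qed.

Lemma bf_wins n P Q : bf n P Q -> wins n P Q [::].
Proof.
elim: n P Q => [|n IHn] P Q /=; first by split.
have key x y : P x -> Q y -> bf n (below P x) (below Q y) ->
    bf n (above P x) (above Q y) -> wins n P Q [:: (x, y)].
  by move=> Px Qy /IHn b /IHn a; apply: wins_cat b a _ _ _.
move=> [PQ QP]; split=> //; split=> [x Px|y Qy].
- by have [y Qy [b a]] := PQ x Px; exists y => //; exact: key.
- by have [x Px [b a]] := QP y Qy; exists x => //; exact: key.
Qed.

(* [None] stands for the missing endpoint. *)
Definition gap (lo hi : option (X * Y)) : set X * set Y :=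
  ([set x | (if lo is Some a then a.1 < x else true) &&
            (if hi is Some b then x < b.1 else true)],
   [set y | (if lo is Some a then a.2 < y else true) &&
            (if hi is Some b then y < b.2 else true)]).

Lemma lt_corr s a b : order_correspondence s -> a \in s -> b \in s ->
  (a.1 < b.1) = (a.2 < b.2).
Proof. by move=> oc sa sb; rewrite !ltNge oc. Qed.

(** The pairs [lo] and [hi] are any chosen pairs, not necessarily neighbours. As answers keep their
    order relative to them, a move inside the gap is answered inside it and cuts it into two
    gaps. *)
Lemma wins_bf n s lo hi : wins n setT setT s ->
  (forall a, lo = Some a -> a \in s) -> (forall b, hi = Some b -> b \in s) ->
  bf n (gap lo hi).1 (gap lo hi).2.
Proof.
elim: n s lo hi => [//|n IHn] s lo hi [_ [XY YX]] slo shi.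
have gapE x y : wins n setT setT ((x, y) :: s) ->
    ((gap lo hi).1 x <-> (gap lo hi).2 y) /\
    ((gap lo hi).1 x -> bf n (below (gap lo hi).1 x) (below (gap lo hi).2 y) /\
                       bf n (above (gap lo hi).1 x) (above (gap lo hi).2 y)).
  move=> w; have oc := wins_corr w.
  have slo' a : lo = Some a -> a \in (x, y) :: s.
    by move=> /slo sa; rewrite inE sa orbT.
  have shi' a : hi = Some a -> a \in (x, y) :: s.
    by move=> /shi sa; rewrite inE sa orbT.
  have sxy c : Some (x, y) = Some c -> c \in (x, y) :: s.
    by move=> [<-]; rewrite mem_head.
  have loE : (if lo is Some a then a.1 < x else true) =
             (if lo is Some a then a.2 < y else true).
    case: (lo) slo' => // a /(_ a erefl) sa.
    by rewrite (lt_corr oc sa (mem_head _ _)).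
  have hiE : (if hi is Some a then x < a.1 else true) =
             (if hi is Some a then y < a.2 else true).
    case: (hi) shi' => // a /(_ a erefl) sa.
    by rewrite -(lt_corr oc (mem_head _ _) sa).
  have gapxy : (gap lo hi).1 x <-> (gap lo hi).2 y by rewrite /= loE hiE.
  split=> // gx; have gy := gapxy.1 gx.
  have [/= gx1 gx2] := andP gx; have [/= gy1 gy2] := andP gy.
  split.
  - have -> : below (gap lo hi).1 x = (gap lo (Some (x, y))).1.
      apply/seteqP; split=> z /=.
        by case=> /andP[zlo _] zx; apply/andP.
      move=> /andP[zlo zx]; split=> //; apply/andP; split=> //.
      by case: (hi) gx2 => //= b; exact: lt_trans.
    have -> : below (gap lo hi).2 y = (gap lo (Some (x, y))).2.
      apply/seteqP; split=> z /=.
        by case=> /andP[zlo _] zx; apply/andP.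
      move=> /andP[zlo zx]; split=> //; apply/andP; split=> //.
      by case: (hi) gy2 => //= b; exact: lt_trans.
    exact: IHn w _ _.
  - have -> : above (gap lo hi).1 x = (gap (Some (x, y)) hi).1.
      apply/seteqP; split=> z /=.
        by case=> /andP[_ zhi] zx; apply/andP.
      move=> /andP[zx zhi]; split=> //; apply/andP; split=> //.
      by case: (lo) gx1 => //= b /lt_trans; exact.
    have -> : above (gap lo hi).2 y = (gap (Some (x, y)) hi).2.
      apply/seteqP; split=> z /=.
        by case=> /andP[_ zhi] zx; apply/andP.
      move=> /andP[zx zhi]; split=> //; apply/andP; split=> //.
      by case: (lo) gy1 => //= b /lt_trans; exact.
    exact: IHn w _ _.
split=> [x gx|y gy].
- have [y _ /gapE[gxy /(_ gx) ba]] := XY x I.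
  by exists y => //; apply/gxy.
- have [x _ /gapE[gxy ba]] := YX y I.
  by exists x; [apply/gxy|apply/ba/gxy].
Qed.

Lemma wins_equiv n : wins n setT setT [::] -> bf_equiv n X Y.
Proof.
move=> w; have := @wins_bf n [::] None None w.
have -> : gap None None = (setT, setT).
  by congr (_, _); apply/seteqP; split.
by apply.
Qed.


(** A strategy supplies the existential answers; conversely, winning answers are selected by choice,
    with [x0] and [y0] as default values. *)
Lemma ef_equiv_wins n (x0 : X) (y0 : Y) :
  ef_equiv X Y n <-> wins n setT setT [::].
Proof.
split=> [[sigma win]|w].
  (* Any continuation shows that the position itself is sound; here player I just repeats [x0]. *)
  have corr k past s :
      (forall moves, size moves = k ->
        order_correspondence (play sigma past moves ++ s)) ->
      order_correspondence s.
    move=> /(_ (nseq k (inl x0))); rewrite size_nseq => /(_ erefl).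
    by apply: sub_order_correspondence => a; rewrite mem_cat orbC => ->.
  suff H k past s :
      (forall moves, size moves = k ->
        order_correspondence (play sigma past moves ++ s)) ->
      wins k setT setT s.
    by apply: (H _ [::]) => moves sz; rewrite cats0; exact: win.
  elim: k past s => [|k IHk] past s h.
    by split=> //; exact: (h [::]).
  split; first exact: corr h.
  split=> [x _|y _].
  - exists (answerY sigma past x) => //; apply: (IHk (rcons past (inl x))).
    move=> moves sz; have := h (inl x :: moves); rewrite /= sz => /(_ erefl).
    apply: sub_order_correspondence => a.
    by rewrite /= !(inE, mem_cat) orbCA.
  - exists (answerX sigma past y) => //; apply: (IHk (rcons past (inr y))).
    move=> moves sz; have := h (inr y :: moves); rewrite /= sz => /(_ erefl).
    apply: sub_order_correspondence => a.
    by rewrite /= !(inE, mem_cat) orbCA.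
pose repY k s x := xget y0 [set y | wins k setT setT ((x, y) :: s)].
pose repX k s y := xget x0 [set x | wins k setT setT ((x, y) :: s)].
pose pair k s (m : X + Y) :=
  match m with inl x => (x, repY k s x) | inr y => (repX k s y, y) end.
(* A strategy sees only the earlier moves of player I, so the position is recomputed from them by
   folding; the first component counts the moves that remain. *)
pose step st m := (st.1.-1, pair st.1.-1 st.2 m :: st.2).
pose state past := foldl step (n, [::]) past.
pose sigma := {|
  answerY past x := (pair (state past).1.-1 (state past).2 (inl x)).2;
  answerX past y := (pair (state past).1.-1 (state past).2 (inr y)).1 |}.
have stepP past m : state (rcons past m) = step (state past) m.
  by rewrite /state foldl_rcons.
have playS past m moves : play sigma past (m :: moves) =
    pair (state past).1.-1 (state past).2 m :: play sigma (rcons past m) moves.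
  by case: m.
have winS k s m : wins k.+1 setT setT s -> wins k setT setT (pair k s m :: s).
  move=> [_ [XY YX]]; case: m => [x|y] /=.
  - by have [y _] := XY x I; apply: (@xgetI _ y0 [set y | wins k setT setT ((x, y) :: s)]).
  - by have [x _] := YX y I; apply: (@xgetI _ x0 [set x | wins k setT setT ((x, y) :: s)]).
exists sigma => moves sz.
suff H k past : (state past).1 = k -> wins k setT setT (state past).2 ->
    forall moves, size moves = k ->
    order_correspondence (play sigma past moves ++ (state past).2).
  by have := H n [::] erefl w moves sz; rewrite cats0.
elim: k past => [|k IHk] past stk wk [|m ms] // => [_|[szk]].
  exact: wins_corr wk.
rewrite playS stk /=.
have := IHk (rcons past m); rewrite stepP /= stk => /(_ erefl (winS _ _ _ wk)).
move=> /(_ ms szk); apply: sub_order_correspondence => a.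
by rewrite !(inE, mem_cat) orbCA.
Qed.

End Game.

(** * Equivalence of orders and the length *)

Lemma ef_equivP (X Y : linorder) n (x0 : X) (y0 : Y) : ef_equiv X Y n <-> bf_equiv n X Y.
Proof.
rewrite (ef_equiv_wins _ x0 y0); split; [exact: wins_equiv|exact: bf_wins].
Qed.

(** By [bf_leq] the level is unique, so the choice made by [xget] is forced. *)
Lemma ef_length_Some (X Y : linorder) l (x0 : X) (y0 : Y) :
  bf_equiv l.+1 X Y -> ~ bf_equiv l.+2 X Y -> ef_length X Y = Some l.+1.
Proof.
move=> el el1; rewrite /ef_length asboolF; last first.
  by move=> /(_ l.+2 erefl); rewrite (ef_equivP _ x0 y0).
congr Some; have eP : [/\ (0 < l.+1)%N, ef_equiv X Y l.+1 & ~ ef_equiv X Y l.+2].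
  by split=> //; rewrite (ef_equivP _ x0 y0).
have : [set n | [/\ (0 < n)%N, ef_equiv X Y n & ~ ef_equiv X Y n.+1]] l.+1 by [].
case/(xgetI 0) => _; set n := xget _ _.
rewrite !(ef_equivP _ x0 y0) => en en1.
apply/eqP; rewrite eqn_leq -ltnS -(ltnS l.+1); apply/andP; split; rewrite ltnNge; apply/negP.
- by move=> /bf_leq/(_ en).
- by move=> /bf_leq/(_ el).
Qed.

Lemma ef_length_None (X Y : linorder) (x0 : X) (y0 : Y) :
  (forall n, bf_equiv n X Y) -> ef_length X Y = None.
Proof.
move=> e; rewrite /ef_length asboolT // => n _.
by rewrite (ef_equivP _ x0 y0).
Qed.

(** Non-empty orders are always 1-equivalent, so the first failure, if any, is at level 2 or
    later. *)
Lemma ef_lengthP (X Y : linorder) (x0 : X) (y0 : Y) :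
  (forall n, bf_equiv n X Y) \/
  (exists l, bf_equiv l.+1 X Y /\ ~ bf_equiv l.+2 X Y).
Proof.
have [e|/existsNP[n en]] := pselect (forall n, bf_equiv n X Y); first by left.
right; elim: n en => [|n IHn] en; first by case: en.
have [|/IHn//] := pselect (bf_equiv n X Y).
case: n {IHn} en => [|n] en en'; last by exists n.
by case: en; apply/bf1P; split=> _; [exists y0|exists x0].
Qed.

(** The levels are nested, so the conjunction fails first where one of its two members does. *)
Lemma ef_length_min (X Y X1 Y1 X2 Y2 : linorder) (x : X) (y : Y) (x1 : X1) (y1 : Y1)
    (x2 : X2) (y2 : Y2) :
  (forall n, bf_equiv n X Y <-> bf_equiv n X1 Y1 /\ bf_equiv n X2 Y2) ->
  ef_length X Y = ext_min (ef_length X1 Y1) (ef_length X2 Y2).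
Proof.
move=> e.
have [e1|[l1 [e1 ne1]]] := ef_lengthP x1 y1;
  have [e2|[l2 [e2 ne2]]] := ef_lengthP x2 y2.
- rewrite (ef_length_None x1 y1 e1) (ef_length_None x2 y2 e2).
  by apply: (ef_length_None x y) => n; apply/e.
- rewrite (ef_length_None x1 y1 e1) (ef_length_Some x2 y2 e2 ne2).
  by apply: (ef_length_Some x y) => [|/e[]//]; apply/e.
- rewrite (ef_length_None x2 y2 e2) (ef_length_Some x1 y1 e1 ne1).
  by apply: (ef_length_Some x y) => [|/e[]//]; apply/e.
- rewrite (ef_length_Some x1 y1 e1 ne1) (ef_length_Some x2 y2 e2 ne2) /= minnSS.
  have [l12|/ltnW l21] := leqP l1 l2.
  + apply: (ef_length_Some x y) => [|/e[]//]; apply/e; split=> //.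
    exact: bf_leq e2.
  + apply: (ef_length_Some x y) => [|/e[]//]; apply/e; split=> //.
    exact: bf_leq e1.
Qed.

(** * Limits, reversal and isomorphisms *)

Section Limits.
Implicit Types X Y : linorder.

Definition limits X (P : set X) : set X :=
  [set x | [/\ P x, below P x !=set0 & ~ max_in (below P x)]].

Lemma limits_below X (P : set X) x : limits (below P x) = below (limits P) x.
Proof.
apply/seteqP; split=> z.
  by case=> -[Pz zx]; rewrite below_below.
by case=> -[Pz bz mz] zx; split=> //; rewrite below_below.
Qed.

(** Since [P x], a limit above [x] has points of [P] in between, and a greatest one among those
    would be greatest among all points below the limit. *)
Lemma limits_above X (P : set X) x :
  P x -> limits (above P x) = above (limits P) x.
Proof.
move=> Px; apply/seteqP; split=> z.
- case=> -[Pz xz] [w [[Pw xw] wz]] nomax; split=> //; split=> //.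
    by exists w.
  case=> m [Pm mz] mmax; apply: nomax; exists m.
    by do !split=> //; apply: lt_le_trans xw _; exact: mmax.
  by move=> v [[Pv _] vz]; exact: mmax.
- case=> -[Pz _ nomax] xz.
  have bz v : below P z v -> exists2 w, below P z w & v < w.
    move=> bv; apply: contrapT => nw; apply: nomax; exists v => // w bw.
    by rewrite leNgt; apply/negP => vw; apply: nw; exists w.
  split=> //.
    by have [//|w [Pw wz] xw] := bz x; exists w.
  case=> m [[Pm xm] mz] mmax; have [//|w [Pw wz] mw] := bz m.
  have : w <= m by apply: mmax; do !split=> //; exact: lt_trans mw.
  by rewrite leNgt mw.
Qed.

(** A move to a limit is answered as in the game on [P] and [Q]. The answer is again a limit because
    at least two moves remain on its lower side, and [limits] commutes with [below] and [above]. *)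
Lemma bf_limits n X Y (P : set X) (Q : set Y) :
  bf n.+2 P Q -> bf n (limits P) (limits Q).
Proof.
elim: n X Y P Q => // n IHn X Y P Q.
have half X' Y' (R : set X') (S : set Y') : (forall x, R x -> exists2 y, S y &
       bf n.+2 (below R x) (below S y) /\ bf n.+2 (above R x) (above S y)) ->
    forall x, limits R x -> exists2 y, limits S y &
      bf n (below (limits R) x) (below (limits S) y) /\
      bf n (above (limits R) x) (above (limits S) y).
  move=> RS x [Rx bx mx]; have [y Sy [b a]] := RS x Rx; exists y.
    have /bf1P[+ _] := @bf_leq 1 n.+2 _ _ _ _ isT b; move/(_ bx)=> ?; split=> //.
    by move=> my; apply: mx; apply: bf2_max_in my; apply/bf_sym/(bf_leq _ b).
  by rewrite -!limits_below -?limits_above //; split; exact: IHn.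
move=> [PQ QP]; split; first exact: half.
move=> y Qy; have [|x Px [b a]] := half _ _ Q P _ y Qy.
  by move=> z /QP[x Px [b a]]; exists x => //; split; exact: bf_sym.
by exists x => //; split; exact: bf_sym.
Qed.

Lemma limitsP X (x : X) : limits [set: X] x <->
  (exists z, z < x) /\ forall z, z < x -> exists2 w, z < w & w < x.
Proof.
split=> [[_ [z [_ zx]] nomax]|[[z zx] dense]].
  split=> [|v vx]; first by exists z.
  apply: contrapT => nw; apply: nomax; exists v => // w [_ wx].
  by rewrite leNgt; apply/negP => vw; apply: nw; exists w.
split=> //; first by exists z.
case=> m [_ /dense[w mw wx]] /(_ w); rewrite leNgt mw.
by move/(_ (conj I wx)).
Qed.

(** Here [z] is the immediate predecessor of [x]. *)
Lemma not_limits X (x z : X) : z < x -> (forall w, z < w -> x <= w) ->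
  ~ limits [set: X] x.
Proof. by move=> zx zxs /limitsP[_ /(_ z zx)[w /zxs]]; rewrite leNgt => /negP. Qed.

Definition lin_rev X : linorder := LinOrder (X^d)%type.

(** Reversal only exchanges [below] and [above], up to conversion. *)
Lemma bf_rev n X Y (P : set X) (Q : set Y) :
  @bf (lin_rev X) (lin_rev Y) n P Q <-> bf n P Q.
Proof.
elim: n P Q => // n IHn P Q.
split=> -[PQ QP]; split=> [x /PQ[y Qy [b a]]|y /QP[x Qx [b a]]];
  by [exists y => //; split; apply/IHn|exists x => //; split; apply/IHn].
Qed.

Lemma bf_equiv_rev n X Y : bf_equiv n (lin_rev X) (lin_rev Y) <-> bf_equiv n X Y.
Proof. exact: bf_rev. Qed.

Lemma lt_rev X (x y : X) : ((x : lin_rev X) < (y : lin_rev X)) = (y < x).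
Proof. by []. Qed.

Lemma lt_mul X Y (a b : lin_mul X Y) :
  (a < b) = (a.1 < b.1) || (a.1 == b.1) && (a.2 < b.2).
Proof. by rewrite ltEprodlexi; case: (ltgtP a.1 b.1). Qed.

Lemma lt_inl X Y (x x' : X) :
  ((inl x : lin_add X Y) < (inl x' : lin_add X Y)) = (x < x').
Proof. by rewrite !ltNge. Qed.

Lemma lt_inr X Y (y y' : Y) :
  ((inr y : lin_add X Y) < (inr y' : lin_add X Y)) = (y < y').
Proof. by rewrite !ltNge. Qed.

Lemma lt_inlr X Y (x : X) (y : Y) :
  (inl x : lin_add X Y) < (inr y : lin_add X Y).
Proof. by rewrite ltNge. Qed.

Lemma lt_inrl X Y (x : X) (y : Y) :
  ((inr y : lin_add X Y) < (inl x : lin_add X Y)) = false.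
Proof. by rewrite ltNge. Qed.

Lemma mono_lt_inj X Y (f : X -> Y) : {mono f : x y / x < y} -> injective f.
Proof.
move=> fm x y fxy; have [xy|yx|//] := ltgtP x y.
  by move: xy; rewrite -fm fxy ltxx.
by move: yx; rewrite -fm fxy ltxx.
Qed.

Definition iso X Y := exists2 f : X -> Y,
  (forall y, exists x, f x = y) & {mono f : x y / x < y}.

Lemma iso_equiv n X Y : iso X Y -> bf_equiv n X Y.
Proof.
move=> [f fs fm]; apply: (@bf_iso _ _ _ _ _ f) => // y _.
by have [x] := fs y; exists x.
Qed.

Lemma iso_refl X : iso X X.
Proof. by exists id => // y; exists y. Qed.

Lemma iso_trans X Y Z : iso X Y -> iso Y Z -> iso X Z.
Proof.
move=> [f fs fm] [g gs gm]; exists (g \o f) => [z|x x'] /=.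
  by have [y <-] := gs z; have [x <-] := fs y; exists x.
by rewrite gm fm.
Qed.

Lemma iso_sym X Y : iso X Y -> iso Y X.
Proof.
move=> [f fs fm]; have [g gf] := choice fs; exists g => [x|y y'].
  by exists (f x); apply: (mono_lt_inj fm).
by rewrite -fm !gf.
Qed.

Lemma bf_equiv_sym n X Y : bf_equiv n X Y -> bf_equiv n Y X.
Proof. exact: bf_sym. Qed.

Lemma bf_equiv_trans n X Y Z : bf_equiv n X Y -> bf_equiv n Y Z -> bf_equiv n X Z.
Proof. exact: bf_trans. Qed.

(** This is the direction of the theorem that holds without exception: $l(A,B)$ is at least the
    minimum. *)
Lemma bf_equiv_add n X X' Y Y' :
  bf_equiv n X X' -> bf_equiv n Y Y' -> bf_equiv n (lin_add X Y) (lin_add X' Y').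
Proof.
have splitT (A B : linorder) :
    [set: lin_add A B] = [set inl a | a in setT] `|` [set inr b | b in setT].
  by apply/seteqP; split=> // -[a|b] _; [left; exists a|right; exists b].
have lt12 (A B : linorder) (x1 x2 : lin_add A B) :
    [set inl a | a in setT] x1 -> [set inr b | b in setT] x2 -> x1 < x2.
  by move=> [a _ <-] [b _ <-]; exact: lt_inlr.
have img (A B : linorder) (f : A -> B) : {mono f : x y / x < y} ->
    bf n [set f a | a in setT] [set: A].
  move=> fm; apply/bf_sym/(@bf_iso _ _ _ _ _ f) => [x _|_ [x _ <-]|x y _ _].
  - by exists x.
  - by exists x.
  - exact: fm.
move=> XX' YY'; rewrite /bf_equiv !splitT; apply: bf_cat; [exact: lt12..| |].
- apply: bf_trans (img X _ _ (@lt_inl X Y)) _.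
  apply: bf_trans XX' _; exact/bf_sym/img/(@lt_inl X' Y').
- apply: bf_trans (img Y _ _ (@lt_inr X Y)) _.
  apply: bf_trans YY' _; exact/bf_sym/img/(@lt_inr X' Y').
Qed.

Lemma iso_add X X' Y Y' :
  iso X X' -> iso Y Y' -> iso (lin_add X Y) (lin_add X' Y').
Proof.
move=> [f fs fm] [g gs gm].
exists (fun a => match a with inl x => inl (f x) | inr y => inr (g y) end).
  move=> [x|y]; first by have [x' <-] := fs x; exists (inl x').
  by have [y' <-] := gs y; exists (inr y').
by move=> [x|x] [y|y]; rewrite ?lt_inl ?lt_inr ?lt_inlr ?lt_inrl ?fm ?gm.
Qed.

Lemma iso_rev X Y : iso X Y -> iso (lin_rev X) (lin_rev Y).
Proof. by move=> [f fs fm]; exists f => // x y; exact: fm. Qed.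

Lemma iso_rev_rev X : iso (lin_rev (lin_rev X)) X.
Proof. by exists id => // x; exists x. Qed.

Lemma iso_rev_add X Y :
  iso (lin_rev (lin_add X Y)) (lin_add (lin_rev Y) (lin_rev X)).
Proof.
exists (fun a : lin_add X Y =>
  match a return lin_add (lin_rev Y) (lin_rev X) with
  inl x => inr x | inr y => inl y end).
  by move=> [y|x]; [exists (inr y)|exists (inl x)].
move=> [x|x] [y|y]; rewrite ?lt_inl ?lt_inr ?lt_inlr ?lt_inrl !lt_rev;
  by rewrite ?lt_inl ?lt_inr ?lt_inlr ?lt_inrl.
Qed.

Lemma iso_mul X X' Y Y' :
  iso X X' -> iso Y Y' -> iso (lin_mul X Y) (lin_mul X' Y').
Proof.
move=> [f fs fm] [g gs gm].
exists (fun a : lin_mul X Y => (g a.1, f a.2) : lin_mul X' Y').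
  move=> [y x]; have [y' <-] := gs y; have [x' <-] := fs x.
  by exists (y', x').
by move=> a b; rewrite !lt_mul /= fm gm (inj_eq (mono_lt_inj gm)).
Qed.

Lemma iso_mulA X Y Z :
  iso (lin_mul (lin_mul X Y) Z) (lin_mul X (lin_mul Y Z)).
Proof.
exists (fun a : lin_mul (lin_mul X Y) Z =>
  ((a.1, a.2.1), a.2.2) : lin_mul X (lin_mul Y Z)).
  by move=> [[z y] x]; exists (z, (y, x)).
move=> [z [y x]] [z' [y' x']]; rewrite !lt_mul /=.
by rewrite -pair_eqE /= /pair_eq /=; case: (ltgtP z z').
Qed.

Lemma iso_mul1 X : iso X (lin_mul X lin_one).
Proof.
exists (fun x => (ord0, x) : lin_mul X lin_one).
  by move=> [i x]; exists x; rewrite (ord1 i).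
by move=> x y; rewrite lt_mul /= ?ltxx ?eqxx.
Qed.

Lemma iso_rev_mul X Y :
  iso (lin_mul (lin_rev X) (lin_rev Y)) (lin_rev (lin_mul X Y)).
Proof.
exists id => [a|a b]; first by exists a.
by rewrite lt_rev !lt_mul eq_sym.
Qed.

End Limits.

(** * Multiples of omega *)

Definition has_min (Y : linorder) := min_in [set: Y].

(** These points index the copies in $\omega \cdot Y$ whose first point is a limit. *)
Definition nonmin (Y : linorder) : set Y := [set y | exists z, z < y].

Arguments nonmin : clear implicits.

Section OmegaMul.
Implicit Types X Y : linorder.

(** [segment], [tail] and [over] are the pieces into which moves cut $\omega \cdot Y$: a finite
    interval of one copy, a final part of one copy, and whole copies. *)
Definition segment Y (y : Y) (i j : nat) : set (lin_mul omega Y) :=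
  [set a | a.1 = y /\ (i <= a.2 < j)%N].

Definition tail Y (y : Y) (i : nat) : set (lin_mul omega Y) :=
  [set a | a.1 = y /\ (i <= a.2)%N].

Definition over Y (Z : set Y) : set (lin_mul omega Y) := [set a | Z a.1].

Definition pt Y (y : Y) (i : nat) : lin_mul omega Y := (y, i).

Lemma lt_omega_mul Y (a b : lin_mul omega Y) :
  (a < b) = (a.1 < b.1) || (a.1 == b.1) && (a.2 < b.2)%N.
Proof. by rewrite lt_mul ltEnat. Qed.

Lemma bf_segment n Y Y' (y : Y) (y' : Y') i j :
  bf n (segment y i j) (segment y' i j).
Proof.
apply: (@bf_iso n (lin_mul omega Y) (lin_mul omega Y') _ _ (fun a => pt y' a.2)).
- by move=> a [].
- by move=> [w k] [/= -> ik]; exists (pt y k).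
- move=> [w k] [w' l] /set_mem[/= -> _] /set_mem[/= -> _].
  by rewrite !lt_omega_mul /= !ltxx !eqxx.
Qed.

(** A tail followed by whole copies is again cut into pieces of the same kinds, which keeps the
    induction in [bf_tail_over] closed. *)
Lemma below_tail_over Y (y : Y) i (Z : set Y) z j :
  (forall w, Z w -> y < w) -> Z z ->
  below (tail y i `|` over Z) (pt z j) =
  (tail y i `|` over (below Z z)) `|` segment z 0 j.
Proof.
move=> yZ Zz; apply/seteqP; split=> -[w k].
  rewrite /below /= lt_omega_mul /= => -[h /orP[wz|/andP[/eqP wz kj]]].
    by left; case: h => h; [left|right].
  by right.
case=> [[[/= -> ik]|[Zw wz]]|[/= -> kj]].
- by split; [left|rewrite lt_omega_mul yZ].
- by split; [right|rewrite lt_omega_mul /= wz].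
- by split; [right|rewrite lt_omega_mul /= eqxx ltxx].
Qed.

Lemma above_tail_over Y (y : Y) i (Z : set Y) z j :
  (forall w, Z w -> y < w) -> Z z ->
  above (tail y i `|` over Z) (pt z j) = tail z j.+1 `|` over (above Z z).
Proof.
move=> yZ Zz; apply/seteqP; split=> -[w k].
  rewrite /above /= lt_omega_mul /= => -[h /orP[zw|/andP[/eqP zw jk]]].
    by right; case: h => // -[/= wy _]; move: zw; rewrite wy ltNge ltW ?yZ.
  by left.
case=> [[/= -> jk]|[Zw zw]].
- by split; [right|rewrite lt_omega_mul /= eqxx ltxx].
- by split; [right|rewrite lt_omega_mul /= zw].
Qed.

Lemma below_tail_over0 Y (y : Y) i (Z : set Y) j :
  (forall w, Z w -> y < w) ->
  below (tail y i `|` over Z) (pt y j) = segment y i j.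
Proof.
move=> yZ; apply/seteqP; split=> -[w k].
  rewrite /below /= lt_omega_mul /= => -[h /orP[wz|/andP[/eqP wz kj]]].
    case: h => [[/= wy _]|Zw]; first by move: wz; rewrite wy ltxx.
    by have := lt_trans wz (yZ _ Zw); rewrite ltxx.
  case: h => [[_ /= ik]|/yZ]; last by rewrite /= wz ltxx.
  by split=> //=; rewrite ik.
move=> [/= -> /andP[ik kj]]; split; first by left.
by rewrite lt_omega_mul /= eqxx kj orbT.
Qed.

Lemma above_tail_over0 Y (y : Y) i (Z : set Y) j :
  (forall w, Z w -> y < w) -> (i <= j)%N ->
  above (tail y i `|` over Z) (pt y j) = tail y j.+1 `|` over Z.
Proof.
move=> yZ ij; apply/seteqP; split=> -[w k].
  rewrite /above /= lt_omega_mul /= => -[h /orP[wz|/andP[/eqP wz kj]]].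
    case: h => [[/= wy _]|Zw]; first by move: wz; rewrite wy ltxx.
    by right.
  by left.
case=> [[/= -> jk]|Zw].
- split; first by left; split=> //=; exact: leq_trans ij (ltnW jk).
  by rewrite lt_omega_mul /= eqxx jk orbT.
- by split; [right|rewrite lt_omega_mul yZ].
Qed.

Lemma tail_over_inner Y (y : Y) i (Z : set Y) :
  exists a, inner (tail y i `|` over Z) a.
Proof.
exists (pt y i.+1); split; first by left; split=> /=.
- exists (pt y i); split; first by left; split=> /=.
  by rewrite lt_omega_mul /= eqxx ltnSn orbT.
- exists (pt y i.+2); split; first by left; split=> //=; do 2!apply: leqW.
  by rewrite lt_omega_mul /= eqxx ltnSn orbT.
Qed.

Lemma min_tail_over Y (y : Y) i (Z : set Y) :
  (forall w, Z w -> y < w) -> min_in (tail y i `|` over Z).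
Proof.
move=> yZ; exists (pt y i); first by left; split=> /=.
move=> [w k] [[/= -> ik]|/yZ yw]; rewrite leNgt lt_omega_mul /=.
  by rewrite ltxx eqxx /= -leqNgt.
by rewrite ltNge (ltW yw) /= gt_eqF.
Qed.

Lemma not_max_tail_over Y (y : Y) i (Z : set Y) :
  ~ max_in (tail y i `|` over Z).
Proof.
have ltS w k : pt w k < pt w k.+1 :> lin_mul omega Y.
  by rewrite lt_omega_mul /= eqxx ltnSn orbT.
case=> -[w k] h /(_ (pt w k.+1)); rewrite leNgt ltS => H.
have : is_true false; last by [].
apply: H; case: h => [[/= -> ik]|Zw]; [left; split=> //=; exact: leqW|by right].
Qed.

(* The first copy of omega is a fixed reference point, which is why its index [y]
   does not take part in the game on [Z] and [Z']. *)
Lemma bf_tail_over k Y Y' (y : Y) (y' : Y') i (Z : set Y) (Z' : set Y') :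
  (forall z, Z z -> y < z) -> (forall z, Z' z -> y' < z) ->
  bf k Z Z' -> bf k.+2 (tail y i `|` over Z) (tail y' i `|` over Z').
Proof.
elim: k Y Y' y y' i Z Z' => [|k IHk] Y Y' y y' i Z Z' yZ yZ'.
  move=> _; apply: bf2; [|by split=> /not_max_tail_over|exact: tail_over_inner..].
  by split=> _; exact: min_tail_over.
have half (T T' : linorder) (t : T) (t' : T') (R : set T) (R' : set T') :
    (forall z, R z -> t < z) -> (forall z, R' z -> t' < z) -> bf k.+1 R R' ->
    forall a, (tail t i `|` over R) a -> exists2 b, (tail t' i `|` over R') b &
      bf k.+2 (below (tail t i `|` over R) a) (below (tail t' i `|` over R') b) /\
      bf k.+2 (above (tail t i `|` over R) a) (above (tail t' i `|` over R') b).
  move=> tR tR' RR' [z j] [[/= -> ij]|/= Rz].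
    (* A move in the reference copy is answered at the same index: the segments below are
       isomorphic, and the tails above start just after it. *)
    exists (pt t' j); first by left.
    rewrite !below_tail_over0 // !above_tail_over0 //.
    by split; [exact: bf_segment|apply: IHk => //; exact: bfW].
  (* A move in a later copy is answered as in the game on [R] and [R'], at the same index in the
     copy. Below, the old tail stays the reference; above, the rest of the copy of [z] becomes the
     new one. *)
  case: RR' => /(_ z Rz)[z' Rz' [b a]] _; exists (pt z' j); first by right.
  rewrite !below_tail_over // !above_tail_over //; split; last first.
    by apply: IHk a => w [].
  apply: bf_cat; last exact: bf_segment.
  - move=> [w l] [w' l'] /= [[/= -> _]|[_ wz]] [/= -> _]; rewrite lt_omega_mul /=.
      by rewrite tR.
    by rewrite wz.
  - move=> [w l] [w' l'] /= [[/= -> _]|[_ wz]] [/= -> _]; rewrite lt_omega_mul /=.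
      by rewrite tR'.
    by rewrite wz.
  - apply: IHk b => w [Rw _]; [exact: tR|exact: tR'].
move=> ZZ'; split; first exact: half.
move=> b bP; have [a aP [h1 h2]] := half _ _ y' y Z' Z yZ' yZ (bf_sym ZZ') b bP.
by exists a => //; split; exact: bf_sym.
Qed.

(** Without a least copy there is no reference copy at the start. After a move in the copy of [z],
    the rest of that copy is one for the part above, so [bf_tail_over] applies there, while the part
    below again has no least copy and falls under the induction. *)
Lemma bf_over k Y Y' (Z : set Y) (Z' : set Y') :
  Z !=set0 -> Z' !=set0 -> ~ min_in Z -> ~ min_in Z' ->
  bf k Z Z' -> bf k.+2 (over Z) (over Z').
Proof.
have nomin (T : linorder) (R : set T) z : ~ min_in R -> R z ->
    exists2 w, R w & w < z.
  move=> nR Rz; apply: contrapT => nw; apply: nR; exists z => // w Rw.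
  by rewrite leNgt; apply/negP => wz; apply: nw; exists w.
elim: k Y Y' Z Z' => [|k IHk] Y Y' Z Z' Z0 Z'0 nZ nZ'.
  have over_nomin (T : linorder) (R : set T) : ~ min_in R -> ~ min_in (over R).
    move=> nR [[z i] Rz]; have [w Rw wz] := nomin _ _ _ nR Rz.
    by move=> /(_ (pt w i) Rw); rewrite leNgt lt_omega_mul /= wz.
  have over_nomax (T : linorder) (R : set T) : ~ max_in (over R).
    move=> [[z i] Rz /(_ (pt z i.+1) Rz)].
    by rewrite leNgt lt_omega_mul /= eqxx ltnSn orbT.
  have over_inner (T : linorder) (R : set T) : R !=set0 -> exists a, inner (over R) a.
    move=> [z Rz]; exists (pt z 1); split=> //.
      by exists (pt z 0); split=> //; rewrite lt_omega_mul /= eqxx orbT.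
    by exists (pt z 2); split=> //; rewrite lt_omega_mul /= eqxx orbT.
  move=> _; apply: bf2; [|by split=> /over_nomax|exact: over_inner..].
  by split=> /over_nomin; case.
have half (T T' : linorder) (R : set T) (R' : set T') :
    ~ min_in R -> ~ min_in R' -> bf k.+1 R R' ->
    forall a, over R a -> exists2 b, over R' b &
      bf k.+2 (below (over R) a) (below (over R') b) /\
      bf k.+2 (above (over R) a) (above (over R') b).
  have belowE (S : linorder) (Q : set S) z j : Q z ->
      below (over Q) (pt z j) = over (below Q z) `|` segment z 0 j.
    move=> Qz; apply/seteqP; split=> -[w l]; rewrite /below /= lt_omega_mul /=.
      by case=> Qw /orP[wz|/andP[/eqP -> lj]]; [left|right].
    by case=> [[/= Qw ->]|[/= -> ->]]; rewrite ?eqxx ?orbT.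
  have aboveE (S : linorder) (Q : set S) z j : Q z ->
      above (over Q) (pt z j) = tail z j.+1 `|` over (above Q z).
    move=> Qz; apply/seteqP; split=> -[w l]; rewrite /above /= lt_omega_mul /=.
      by case=> Qw /orP[wz|/andP[/eqP -> lj]]; [right|left].
    by case=> [[/= -> ->]|[/= Qw ->]]; rewrite ?eqxx ?orbT.
  have nobelow (S : linorder) (Q : set S) z : ~ min_in Q -> Q z ->
      below Q z !=set0 /\ ~ min_in (below Q z).
    move=> nQ Qz; split.
      by have [w Qw wz] := nomin _ _ _ nQ Qz; exists w.
    case=> m [Qm mz] mmin; have [w Qw wm] := nomin _ _ _ nQ Qm.
    have : m <= w by apply: mmin; split=> //; exact: lt_trans mz.
    by rewrite leNgt wm.
  move=> nR nR' [RR' _] [z j] /= Rz; have [z' Rz' [b a]] := RR' z Rz.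
  exists (pt z' j) => //; rewrite !belowE // !aboveE //; split; last first.
    by apply: bf_tail_over a => w [].
  have [nz1 nz2] := nobelow _ _ _ nR Rz.
  have [nz1' nz2'] := nobelow _ _ _ nR' Rz'.
  apply: bf_cat; [| |exact: IHk|exact: bf_segment].
  - by move=> [w l] [w' l'] /= [_ wz] [/= -> _]; rewrite lt_omega_mul /= wz.
  - by move=> [w l] [w' l'] /= [_ wz] [/= -> _]; rewrite lt_omega_mul /= wz.
move=> ZZ'; split; first exact: half.
move=> b bP; have [a aP [h1 h2]] := half _ _ Z' Z nZ' nZ (bf_sym ZZ') b bP.
by exists a => //; split; exact: bf_sym.
Qed.

Lemma nonminT Y : ~ has_min Y -> nonmin Y = [set: Y].
Proof.
move=> nY; apply/seteqP; split=> // y _; apply: contrapT => ny; apply: nY.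
by exists y => // z _; rewrite leNgt; apply/negP => zy; apply: ny; exists z.
Qed.

(** The copy at the least index, if there is one, serves as the reference copy of [bf_tail_over];
    otherwise [bf_over] applies. *)
Lemma bf_omega_mul k Y Y' (y : Y) (y' : Y') : (has_min Y <-> has_min Y') ->
  bf k (nonmin Y) (nonmin Y') ->
  bf_equiv k.+2 (lin_mul omega Y) (lin_mul omega Y').
Proof.
move=> YY'; have [mY|nY] := pselect (has_min Y); last first.
  have nY' : ~ has_min Y' by move/YY'.
  rewrite !nonminT // => b.
  by apply: bf_over b => //; [exists y|exists y'].
have mY' : has_min Y' by apply/YY'.
case: mY => m _ mmin; case: mY' => m' _ mmin' b.
have split (T : linorder) (t : T) : (forall z, [set: T] z -> t <= z) ->
    (forall z, nonmin T z -> t < z) /\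
    [set: lin_mul omega T] = tail t 0 `|` over (nonmin T).
  move=> tmin; split.
    by move=> z [w wz]; apply: le_lt_trans wz; exact: tmin.
  apply/seteqP; split=> // -[z i] _; have [->|tz] := eqVneq z t; first by left.
  by right; exists t; rewrite lt_neqAle eq_sym tz tmin.
have [mlt mE] := split _ _ mmin; have [mlt' mE'] := split _ _ mmin'.
rewrite /bf_equiv mE mE'; exact: bf_tail_over.
Qed.

End OmegaMul.

(** * Sums of two monomials *)

Definition has_max (Y : linorder) := max_in [set: Y].

(** For non-empty [X], the indices of the copies of $\omega$ in $\omega^* \cdot X^* + \omega \cdot
    Y$ whose first point is a limit. As [X] enters reversed, [has_min X] says that the first summand
    has a greatest point. *)
Definition inward_limits (X Y : linorder) : set Y :=
  [set y | nonmin Y y \/ ~ has_min X].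

Arguments inward_limits : clear implicits.

Section Sums.
Implicit Types X Y Z : linorder.

Lemma lt_ptS Y (y : Y) i : pt y i < pt y i.+1.
Proof. by rewrite lt_omega_mul /= eqxx ltnSn orbT. Qed.

Lemma lt_ptS_le Y (y : Y) i (a : lin_mul omega Y) : pt y i < a -> pt y i.+1 <= a.
Proof.
rewrite leNgt !lt_omega_mul /=; apply: contraTN.
move=> /orP[ay|/andP[/eqP-> ai]].
  by rewrite ltNge (ltW ay) /= gt_eqF.
by rewrite ltxx eqxx /= -leqNgt.
Qed.

Lemma has_min_omega_mul Y : has_min (lin_mul omega Y) <-> has_min Y.
Proof.
split=> [[[y i] _ h]|[y _ h]].
  exists y => // z _; have := h (pt z 0) I.
  by rewrite leNgt lt_omega_mul /= negb_or -leNgt => /andP[].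
exists (pt y 0) => // -[z i] _; rewrite leNgt lt_omega_mul /= ltn0 andbF orbF.
by rewrite -leNgt; exact: h.
Qed.

Lemma not_has_min_rev_omega_mul Y : ~ has_min (lin_rev (lin_mul omega Y)).
Proof.
by case=> -[y i] _ /(_ (pt y i.+1) I); rewrite leNgt lt_rev lt_ptS.
Qed.

Lemma has_min_add X Y (x : X) : has_min (lin_add X Y) <-> has_min X.
Proof.
split=> [[[m|m] _ h]|[m _ h]].
- by exists m => // z _; have := h (inl z) I; rewrite !leNgt lt_inl.
- by move: (h (inl x) I); rewrite leNgt lt_inlr.
- exists (inl m) => // -[z|z] _; rewrite leNgt ?lt_inrl // lt_inl -leNgt.
  exact: h.
Qed.

Lemma iso_has_min X Y : iso X Y -> has_min X <-> has_min Y.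
Proof.
move=> XY; have e := iso_equiv 2 XY.
by split; apply: bf2_min_in => //; exact: bf_sym.
Qed.

Definition outward X Y := lin_add (lin_mul omega X) (lin_rev (lin_mul omega Y)).

(* Up to isomorphism $\omega^* \cdot X^* + \omega \cdot Y$; passing to $X^*$ makes
   reversal exchange the two arguments. *)
Definition inward X Y := lin_add (lin_rev (lin_mul omega X)) (lin_mul omega Y).

Lemma iso_rev_outward X Y : iso (lin_rev (outward X Y)) (outward Y X).
Proof.
apply: iso_trans (iso_rev_add _ _) _.
exact: iso_add (iso_rev_rev _) (iso_refl _).
Qed.

Lemma iso_rev_inward X Y : iso (lin_rev (inward X Y)) (inward Y X).
Proof.
apply: iso_trans (iso_rev_add _ _) _.
exact: iso_add (iso_refl _) (iso_rev_rev _).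
Qed.

Lemma bf_equiv_outward_swap n X Y X' Y' :
  bf_equiv n (outward X Y) (outward X' Y') ->
  bf_equiv n (outward Y X) (outward Y' X').
Proof.
move=> /(bf_equiv_rev _ _ _).2 e.
apply: bf_equiv_trans (bf_equiv_sym (iso_equiv _ (iso_rev_outward X Y))) _.
exact: bf_equiv_trans e (iso_equiv _ (iso_rev_outward X' Y')).
Qed.

Lemma bf_equiv_inward_swap n X Y X' Y' :
  bf_equiv n (inward X Y) (inward X' Y') ->
  bf_equiv n (inward Y X) (inward Y' X').
Proof.
move=> /(bf_equiv_rev _ _ _).2 e.
apply: bf_equiv_trans (bf_equiv_sym (iso_equiv _ (iso_rev_inward X Y))) _.
exact: bf_equiv_trans e (iso_equiv _ (iso_rev_inward X' Y')).
Qed.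

Lemma limits_inl X Y (x : X) :
  limits [set: lin_add X Y] (inl x) <-> limits [set: X] x.
Proof.
split=> /limitsP[[z zx] dense]; apply/limitsP.
- case: z zx => [z|z]; last by rewrite lt_inrl.
  rewrite lt_inl => zx; split=> [|v vx]; first by exists z.
  have [|[w|w]] := dense (inl v); first by rewrite lt_inl.
    by rewrite !lt_inl => vw wx; exists w.
  by rewrite lt_inrl.
- split=> [|[v|v]]; first by exists (inl z); rewrite lt_inl.
    rewrite lt_inl => /dense[w vw wx].
    by exists (inl w); rewrite lt_inl.
  by rewrite lt_inrl.
Qed.

(** A least point of [Y] becomes a limit when [X] has no greatest point; [x0] ensures that something
    lies below it. *)
Lemma limits_inr X Y (x0 : X) (y : Y) :
  limits [set: lin_add X Y] (inr y) <->
  limits [set: Y] y \/ ~ nonmin Y y /\ ~ has_max X.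
Proof.
split=> [/limitsP[_ dense]|].
- have [[z zy]|ymin] := pselect (nonmin Y y).
    left; apply/limitsP; split=> [|v vy]; first by exists z.
    have [|[w|w]] := dense (inr v); rewrite ?lt_inr //.
    by move=> vw wy; exists w.
  right; split=> // -[m _ mmax].
  have [|[w|w]] := dense (inl m); rewrite ?lt_inlr // ?lt_inl ?lt_inr.
    by rewrite ltNge mmax.
  by move=> _ wy; apply: ymin; exists w.
- case=> [/limitsP[[z zy] dense]|[ymin nomax]]; apply/limitsP.
    split=> [|[v|v]]; first by exists (inr z); rewrite lt_inr.
      by exists (inr z); rewrite ?lt_inlr ?lt_inr.
    by rewrite lt_inr => /dense[w vw wy]; exists (inr w); rewrite lt_inr.
  split=> [|[v|v]]; first by exists (inl x0); rewrite lt_inlr.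
    move=> _; apply: contrapT => nw; apply: nomax; exists v => // z _.
    rewrite leNgt; apply/negP => vz; apply: nw; exists (inl z).
      by rewrite lt_inl.
    by rewrite lt_inlr.
  by rewrite lt_inr => vy; case: ymin; exists v.
Qed.

Lemma limits_omega_mul X (a : lin_mul omega X) :
  limits [set: lin_mul omega X] a <-> nonmin X a.1 /\ a.2 = 0.
Proof.
case: a => x [|i] /=; last first.
  split=> [|[]//]; move=> h; exfalso.
  by apply: (@not_limits _ _ (pt x i) _ _ h); [exact: lt_ptS|exact: lt_ptS_le].
split=> [/limitsP[[[z i] + _]]|[[z zx] _]].
  by rewrite lt_omega_mul /= ltn0 andbF orbF => zx; split=> //; exists z.
apply/limitsP; split=> [|[w i]].
  by exists (pt z 0); rewrite lt_omega_mul /= zx.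
rewrite lt_omega_mul /= ltn0 andbF orbF => wx.
by exists (pt w i.+1); [exact: lt_ptS|rewrite lt_omega_mul /= wx].
Qed.

(** Each point has an immediate predecessor in the reversed order, namely its successor in its copy
    of $\omega$. *)
Lemma limits_rev_omega_mul X (a : lin_rev (lin_mul omega X)) :
  ~ limits [set: lin_rev (lin_mul omega X)] a.
Proof.
case: a => x i; apply: (@not_limits (lin_rev (lin_mul omega X)) _ (pt x i.+1)).
  by rewrite lt_rev lt_ptS.
move=> w; rewrite lt_rev => wx; rewrite leNgt lt_rev; apply/negP.
by move=> /lt_ptS_le; rewrite leNgt wx.
Qed.

Lemma has_max_rev_omega_mul X :
  has_max (lin_rev (lin_mul omega X)) <-> has_min X.
Proof. exact: has_min_omega_mul. Qed.

Lemma bf_limits_outward n X Y (x0 : X) :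
  bf n (limits [set: outward X Y]) (nonmin X).
Proof.
apply/bf_sym/(@bf_iso n X (outward X Y) _ _ (fun x => inl (pt x 0))).
- by move=> x nx; apply/limits_inl/limits_omega_mul.
- move=> [[x i]|a].
    by move=> /limits_inl/limits_omega_mul[/= nx ->]; exists x.
  case/(limits_inr (pt x0 0)) => [/limits_rev_omega_mul//|[+ _]].
  by case: a => y i []; exists (pt y i.+1); rewrite lt_rev lt_ptS.
- by move=> x y _ _; rewrite lt_inl lt_omega_mul /= ltnn andbF orbF.
Qed.

(** The sum determines the two data that [bf_omega_mul] asks for: it has a least point exactly when
    [X] has one, and its limits are indexed by [nonmin X]. The two moves lost in [bf_limits] are
    regained in [bf_omega_mul]. *)
Lemma bf_equiv_outward_l n X Y X' Y' (x : X) (x' : X') :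
  bf_equiv n (outward X Y) (outward X' Y') ->
  bf_equiv n (lin_mul omega X) (lin_mul omega X').
Proof.
case: n => [//|[_|n e]].
  by apply/bf1P; split=> _; [exists (pt x' 0)|exists (pt x 0)].
apply: bf_omega_mul => //.
  have hm Z Z' (z : Z) : has_min Z <-> has_min (outward Z Z').
    by rewrite (has_min_add _ (pt z 0)) has_min_omega_mul.
  rewrite (hm X Y) // (hm X' Y') //.
  by split; apply: bf2_min_in; [|apply: bf_sym]; exact: bf_leq e.
apply: bf_trans (bf_sym (bf_limits_outward n Y x)) _.
exact: bf_trans (bf_limits e) (bf_limits_outward n Y' x').
Qed.

Lemma limits_inward_inr X Y (x0 : X) (a : lin_mul omega Y) :
  limits [set: inward X Y] (inr a) <-> inward_limits X Y a.1 /\ a.2 = 0.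
Proof.
apply: iff_trans (limits_inr (pt x0 0 : lin_rev (lin_mul omega X)) a) _.
rewrite has_max_rev_omega_mul limits_omega_mul.
case: a => y [|i] /=; split.
- by case=> [[ny _]|[_ nX]]; split; [left| |right|].
- case=> -[ny _|nX _]; first by left.
  have [ny|ny] := pselect (nonmin Y y); first by left.
  right; split=> // -[[z j]].
  by rewrite lt_omega_mul /= ltn0 andbF orbF => zy; apply: ny; exists z.
- case=> [[]//|[ny _]]; exfalso; apply: ny; exists (pt y i); exact: lt_ptS.
- by case.
Qed.

Lemma bf_limits_inward n X Y (x0 : X) :
  bf n (limits [set: inward X Y]) (inward_limits X Y).
Proof.
apply/bf_sym/(@bf_iso n Y (inward X Y) _ _ (fun y => inr (pt y 0))).
- by move=> y yl; apply/(limits_inward_inr x0).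
- move=> [a /limits_inl/limits_rev_omega_mul//|[y i]].
  by move=> /(limits_inward_inr x0)[/= ly ->]; exists y.
- by move=> x y _ _; rewrite lt_inr lt_omega_mul /= ltnn andbF orbF.
Qed.

End Sums.

(** * Inward sums: the low levels and the passage to the summands *)

Definition colimits (X : linorder) : set X := @limits (lin_rev X) setT.

(* What matters about $Y$ when $\omega \cdot Y$ is a monomial of $k$ alternating
   powers, the first one being $\omega^e$. *)
Record cofactor_shape (k e : nat) (Y : linorder) : Prop := Shape {
  shape_inhabited : inhabited Y;
  shape_min : has_min Y <-> k = 1%N;
  shape_one : k = 1%N -> e = 1%N -> forall y z : Y, y = z;
  shape_mul : k = 1%N -> (1 < e)%N ->
    exists2 Z, iso Y (lin_mul omega Z) & has_min Z
}.

Section Inward.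
Implicit Types X Y Z : linorder.

(** Without a least point in the order, the part below [x] has no least point but has inner points.
    By [bf2] only the existence of a greatest point counts, that is, whether [x] is a limit. *)
Lemma bf2_below X Y (x : X) (y : Y) : ~ has_min X -> ~ has_min Y ->
  (limits [set: X] x <-> limits [set: Y] y) ->
  bf 2 (below [set: X] x) (below [set: Y] y).
Proof.
have lower (T : linorder) (t : T) : ~ has_min T -> exists z, z < t.
  move=> nT; have : nonmin T t by rewrite nonminT.
  by [].
have nomin (T : linorder) (t : T) : ~ has_min T -> ~ min_in (below [set: T] t).
  move=> nT [m [_ mt] mmin]; have [z zm] := lower _ m nT.
  have : m <= z by apply: mmin; split=> //; exact: lt_trans mt.
  by rewrite leNgt zm.
have maxE (T : linorder) (t : T) : ~ has_min T ->
    max_in (below [set: T] t) <-> ~ limits [set: T] t.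
  move=> nT; split=> [mt [_ _]//|nl]; apply: contrapT => nm; apply: nl.
  by have [z zt] := lower _ t nT; split=> //; exists z.
have inn (T : linorder) (t : T) : ~ has_min T ->
    exists z, inner (below [set: T] t) z.
  move=> nT; have [a at'] := lower _ t nT; have [b ba] := lower _ a nT.
  have [c cb] := lower _ b nT; have bt := lt_trans ba at'.
  by exists b; do !split=> //; [exists c|exists a]; do !split=> //; exact: lt_trans bt.
move=> nX nY xy; apply: bf2; [by split=> /nomin|by rewrite !maxE // xy|exact: inn..].
Qed.

(** By [bf2_below] and its reversal, the two moves left see of a point only whether it is a limit
    and whether it is a limit of the reverse order. No point is both, so three kinds remain, and the
    hypotheses provide an answer of each kind. *)
Lemma bf_equiv3 X Y : ~ has_min X -> ~ has_min Y -> ~ has_max X -> ~ has_max Y ->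
  (forall x, limits [set: X] x -> ~ colimits x) ->
  (forall y, limits [set: Y] y -> ~ colimits y) ->
  (exists x : X, ~ limits [set: X] x /\ ~ colimits x) ->
  (exists y : Y, ~ limits [set: Y] y /\ ~ colimits y) ->
  (limits [set: X] !=set0 <-> limits [set: Y] !=set0) ->
  (@colimits X !=set0 <-> @colimits Y !=set0) ->
  bf_equiv 3 X Y.
Proof.
have match_sides (S T : linorder) (x : S) (y : T) : ~ has_min S -> ~ has_min T ->
    ~ has_max S -> ~ has_max T ->
    (limits [set: S] x <-> limits [set: T] y) -> (colimits x <-> colimits y) ->
    bf 2 (below [set: S] x) (below [set: T] y) /\
    bf 2 (above [set: S] x) (above [set: T] y).
  move=> mS mT MS MT lxy cxy; split; first exact: bf2_below.
  exact/bf_rev/(@bf2_below (lin_rev S) (lin_rev T)).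
have half (S T : linorder) : ~ has_min S -> ~ has_min T -> ~ has_max S -> ~ has_max T ->
    (forall x, limits [set: S] x -> ~ colimits x) ->
    (forall y, limits [set: T] y -> ~ colimits y) ->
    (exists y : T, ~ limits [set: T] y /\ ~ colimits y) ->
    (limits [set: S] !=set0 -> limits [set: T] !=set0) ->
    (@colimits S !=set0 -> @colimits T !=set0) ->
    forall x : S, [set: S] x -> exists2 y : T, [set: T] y &
      bf 2 (below [set: S] x) (below [set: T] y) /\
      bf 2 (above [set: S] x) (above [set: T] y).
  move=> mS mT MS MT xS xT [y0 [ly0 cy0]] L C x _.
  have [lx|lx] := pselect (limits [set: S] x).
    have [|y ly] := L; first by exists x.
    exists y => //; apply: match_sides => //.
    by split=> [cx|cy]; [case: (xS x)|case: (xT y)].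
  have [cx|cx] := pselect (colimits x).
    have [|y cy] := C; first by exists x.
    exists y => //; apply: match_sides => //; split=> // ly.
    by case: (xT y).
  by exists y0 => //; apply: match_sides.
move=> mX mY MX MY xX xY nX nY L C; split.
  by apply: half => //; [exact: L.1|exact: C.1].
move=> y _; have [x _ [b a]] := half Y X mY mX MY MX xY xX nX L.2 C.2 y I.
by exists x => //; split; exact: bf_sym.
Qed.

Lemma not_has_min_inward X Y (x : X) : ~ has_min (inward X Y).
Proof.
move/(has_min_add _ (pt x 0 : lin_rev (lin_mul omega X))).
exact: not_has_min_rev_omega_mul.
Qed.

Lemma not_has_max_inward X Y (y : Y) : ~ has_max (inward X Y).
Proof.
move=> h; apply: (@not_has_min_inward Y X y).
exact/(iso_has_min (iso_rev_inward X Y)).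
Qed.

Lemma not_colimits_inr X Y (a : lin_mul omega Y) :
  ~ @colimits (inward X Y) (inr a).
Proof.
case: a => y i; apply: (@not_limits (lin_rev (inward X Y)) _ (inr (pt y i.+1))).
  by rewrite lt_rev lt_inr lt_ptS.
move=> [w|w]; first by rewrite leNgt !lt_rev lt_inlr.
rewrite leNgt !lt_rev !lt_inr => wy; apply/negP => /lt_ptS_le.
by rewrite leNgt wy.
Qed.

Lemma not_limits_inward_inl X Y (a : lin_mul omega X) :
  ~ limits [set: inward X Y] (inl a).
Proof. by move/limits_inl/limits_rev_omega_mul. Qed.

Lemma inward_mid X Y (x : X) (y : Y) : exists a : inward X Y,
  ~ limits [set: inward X Y] a /\ ~ colimits a.
Proof.
exists (inr (pt y 1)); split; last exact: not_colimits_inr.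
by case/(limits_inward_inr x).
Qed.

Lemma bf_colimits_inward n X Y (y : Y) :
  @bf (lin_rev (inward X Y)) X n (@colimits (inward X Y)) (inward_limits Y X).
Proof.
apply: bf_trans (bf_limits_inward n X y).
exact: bf_limits (iso_equiv n.+2 (iso_rev_inward X Y)).
Qed.

(** Limits lie in the second summand and limits of the reverse order in the first, so no point is
    both. *)
Lemma bf_equiv3_inward X Y X' Y' (x : X) (y : Y) (x' : X') (y' : Y') :
  (inward_limits X Y !=set0 <-> inward_limits X' Y' !=set0) ->
  (inward_limits Y X !=set0 <-> inward_limits Y' X' !=set0) ->
  bf_equiv 3 (inward X Y) (inward X' Y').
Proof.
move=> L C.
have dis (S T : linorder) (a : inward S T) : limits [set: inward S T] a -> ~ colimits a.
  by case: a => a; [move/not_limits_inward_inl|move=> _; exact: not_colimits_inr].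
apply: bf_equiv3; [exact: not_has_min_inward|exact: not_has_min_inward|
  exact: not_has_max_inward|exact: not_has_max_inward|exact: dis|exact: dis|
  exact: inward_mid|exact: inward_mid| |].
- have LE (S T : linorder) (s : S) := (bf1P _ _).1 (bf_limits_inward 1 T s).
  by apply: iff_trans (LE X Y x) _; apply: iff_trans L (iff_sym (LE X' Y' x')).
- have CE (S T : linorder) (t : T) := (bf1P _ _).1 (bf_colimits_inward 1 S t).
  by apply: iff_trans (CE X Y y) _; apply: iff_trans C (iff_sym (CE X' Y' y')).
Qed.

Lemma bf_inward_limits n X Y X' Y' (x : X) (x' : X') :
  bf_equiv n.+2 (inward X Y) (inward X' Y') ->
  bf n (inward_limits X Y) (inward_limits X' Y').
Proof.
move=> e; apply: bf_trans (bf_sym (bf_limits_inward n Y x)) _.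
exact: bf_trans (bf_limits e) (bf_limits_inward n Y' x').
Qed.

Lemma bf_equiv2_inward X Y X' Y' (x : X) (y : Y) (x' : X') (y' : Y') :
  bf_equiv 2 (inward X Y) (inward X' Y').
Proof.
have inn (S T : linorder) (t : T) : exists a, inner [set: inward S T] a.
  exists (inr (pt t 1)); split=> //.
    by exists (inr (pt t 0)); split=> //; rewrite lt_inr lt_ptS.
  by exists (inr (pt t 2)); split=> //; rewrite lt_inr lt_ptS.
apply: bf2.
- by split=> [/(not_has_min_inward x)|/(not_has_min_inward x')].
- by split=> [/(not_has_max_inward y)|/(not_has_max_inward y')].
- exact: inn.
- exact: inn.
Qed.

(* Shift the first copy of omega by one. *)
Lemma bf_nonmin_omega_mul n Z : bf n (nonmin (lin_mul omega Z)) [set: lin_mul omega Z].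
Proof.
have [[z0 _ zmin]|nZ] := pselect (has_min Z); last first.
  rewrite nonminT; [exact: bf_refl|by move/has_min_omega_mul].
pose f (a : lin_mul omega Z) := if a.1 == z0 then pt a.1 a.2.-1 else a.
have f1 a : (f a).1 = a.1 by rewrite /f; case: ifP.
(* Index 0 of the first copy is the least point and thus excluded, so the truncated predecessor in
   [f] identifies no two points. *)
have nm a : nonmin (lin_mul omega Z) a -> a.1 = z0 -> (0 < a.2)%N.
  move=> [[w j]]; rewrite lt_omega_mul /= => /orP[wa az|/andP[_]].
    by move: wa; rewrite az ltNge zmin.
  by move=> + _; exact: leq_ltn_trans.
apply: (@bf_iso n _ _ _ _ f) => //.
- move=> [z i] _; have [->|zz0] := eqVneq z z0.
    exists (pt z0 i.+1); first by exists (pt z0 i); exact: lt_ptS.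
    by rewrite /f /= eqxx.
  exists (pt z i); last by rewrite /f /= (negbTE zz0).
  by exists (pt z0 i); rewrite lt_omega_mul /= lt_neqAle eq_sym zz0 zmin.
- move=> a b /set_mem na /set_mem nb; rewrite !lt_omega_mul !f1.
  case: (eqVneq a.1 b.1) => [ab|//]; rewrite /f -ab.
  case: eqP => // az; rewrite /=.
  by rewrite -ltnS !prednK // nm // -ab.
Qed.

Lemma bf_nonmin_iso n X Y : iso X Y -> bf n (nonmin X) (nonmin Y).
Proof.
move=> [f fs fm]; apply: (@bf_iso _ _ _ _ _ f) => [x [z zx]|y [w wy]|].
- by exists (f z); rewrite fm.
- have [x fx] := fs y; have [z fz] := fs w; exists x => //.
  by exists z; rewrite -fm fx fz.
- by move=> ? ? _ _; exact: fm.
Qed.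

Lemma bf_nonmin_iso_omega n Y Z : iso Y (lin_mul omega Z) -> bf n (nonmin Y) [set: Y].
Proof.
move=> YZ; apply: bf_trans (bf_nonmin_iso n YZ) _.
apply: bf_trans (bf_nonmin_omega_mul n Z) _.
exact/bf_sym/(iso_equiv n YZ).
Qed.

(** Either [Y] has no least point and the two sets agree, or [Y] is a multiple of $\omega$ and a
    shift of its first copy makes up for the least point. *)
Lemma bf_nonmin_shape n k e Y : cofactor_shape k e Y -> e <> 0%N -> k <> 1%N \/ e <> 1%N ->
  bf n (nonmin Y) [set: Y].
Proof.
move=> [_ Ymin _ Ymul] e0; have [k1 [//|e1]|k1 _] := pselect (k = 1%N).
  have [|Z YZ _] := Ymul k1; last exact: bf_nonmin_iso_omega YZ.
  by case: e e0 e1 {Ymul} => [|[]].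
by rewrite nonminT; [exact: bf_refl|move/Ymin].
Qed.

(** If [s] is 1, the limits are indexed by [nonmin Y], as [bf_omega_mul] needs. Otherwise they are
    indexed by all of [Y], and the remaining alternatives are what [bf_nonmin_shape] needs to return
    to [nonmin Y] and [nonmin Y']. *)
Lemma bf_equiv_inward_r k X Y X' Y' s t n m u v p q :
  cofactor_shape s m X -> cofactor_shape t n Y -> cofactor_shape u p X' -> cofactor_shape v q Y' ->
  n <> 0%N -> q <> 0%N ->
  (s = 1%N <-> u = 1%N) -> (t = 1%N <-> v = 1%N) ->
  (s = 1%N \/ t <> 1%N \/ (n <> 1%N /\ q <> 1%N)) ->
  bf_equiv k (inward X Y) (inward X' Y') ->
  bf_equiv k (lin_mul omega Y) (lin_mul omega Y').
Proof.
move=> hX hY hX' hY' n0 q0 su tv cond e.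
have [x] := shape_inhabited hX; have [x'] := shape_inhabited hX'.
have [y] := shape_inhabited hY; have [y'] := shape_inhabited hY'.
case: k e => [//|[_|k e]].
  by apply/bf1P; split=> _; [exists (pt y' 0)|exists (pt y 0)].
apply: bf_omega_mul => //; first by rewrite (shape_min hY) (shape_min hY').
have b := bf_inward_limits x x' e.
have [s1|s1] := pselect (s = 1%N).
  have limE (S T : linorder) : has_min S -> inward_limits S T = nonmin T.
    by move=> mS; apply/seteqP; split=> z; [case|left].
  by move: b; rewrite !limE //; [apply/(shape_min hX')/su|apply/(shape_min hX)].
have limE (S T : linorder) : ~ has_min S -> inward_limits S T = setT.
  by move=> mS; apply/seteqP; split=> z //; right.
move: b; rewrite !limE; [|by move/(shape_min hX')/su|by move/(shape_min hX)].
move=> b; apply: bf_trans (bf_nonmin_shape k hY n0 _) _.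
  by case: cond => [//|[]]; [left|case; right].
apply: bf_trans b _; apply/bf_sym/(bf_nonmin_shape k hY' q0).
by case: cond => [//|[t1|[]]]; [left; rewrite -tv|right].
Qed.

(** Limits are missing only if the first summand has a greatest point and [Y] is a single point. *)
Lemma inward_limits_nonempty X Y s t n m : cofactor_shape s m X -> cofactor_shape t n Y -> n <> 0%N ->
  inward_limits X Y !=set0 <-> ~ [/\ s = 1%N, t = 1%N & n = 1%N].
Proof.
move=> hX hY n0; split=> [[y [[z zy]|nX]] [s1 t1 n1]|h].
- by move: zy; rewrite (shape_one hY t1 n1 z y) ltxx.
- by apply: nX; apply/(shape_min hX).
have [y] := shape_inhabited hY.
have [s1|s1] := pselect (s = 1%N); last first.
  by exists y; right => /(shape_min hX).
have [z nz] : nonmin Y !=set0; last by exists z; left.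
have c : t <> 1%N \/ n <> 1%N.
  by have [t1|] := pselect (t = 1%N); [right=> n1; apply: h|left].
by apply/((bf1P _ _).1 (bf_nonmin_shape 1 hY n0 c)); exists y.
Qed.

(** Passing to the limits costs two moves, and two more detect a least point. The index set of the
    limits has one in the first sum, where it is [Y] or equivalent to [Y], and none in the
    second. *)
Lemma not_bf4_inward_min X Y X' Y' s t n m u v p q :
  cofactor_shape s m X -> cofactor_shape t n Y -> cofactor_shape u p X' -> cofactor_shape v q Y' ->
  n <> 0%N -> q <> 0%N -> t = 1%N -> v <> 1%N -> (s <> 1%N \/ n <> 1%N) ->
  ~ bf_equiv 4 (inward X Y) (inward X' Y').
Proof.
move=> hX hY hX' hY' n0 q0 t1 v1 cond.
have [x] := shape_inhabited hX; have [x'] := shape_inhabited hX'.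
move=> /(bf_inward_limits x x') e.
have nY' : ~ has_min Y' by move/(shape_min hY').
have limE' : inward_limits X' Y' = setT.
  by apply/seteqP; split=> z // _; left; rewrite nonminT.
move: e; rewrite limE' => e; apply: nY'.
apply: bf2_min_in e _; have mY : has_min Y by apply/(shape_min hY).
have [s1|s1] := pselect (s = 1%N); last first.
  suff -> : inward_limits X Y = setT by [].
  by apply/seteqP; split=> z // _; right=> /(shape_min hX).
have -> : inward_limits X Y = nonmin Y.
  apply/seteqP; split=> z; [case=> // nX; case: nX|by left].
  exact/(shape_min hX).
have n1 : t <> 1%N \/ n <> 1%N by right; case: cond.
exact: bf2_min_in (bf_sym (bf_nonmin_shape 2 hY n0 n1)) mY.
Qed.

(** The limits are indexed by all of [Y] and all of [Y']: a single point against a multiple of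
    $\omega$, told apart by two moves. *)
Lemma not_bf4_inward_one X Y X' Y' s t n m u v p q :
  cofactor_shape s m X -> cofactor_shape t n Y -> cofactor_shape u p X' -> cofactor_shape v q Y' ->
  s <> 1%N -> u <> 1%N -> t = 1%N -> v = 1%N -> n = 1%N -> (1 < q)%N ->
  ~ bf_equiv 4 (inward X Y) (inward X' Y').
Proof.
move=> hX hY hX' hY' s1 u1 t1 v1 n1 q1.
have [x] := shape_inhabited hX; have [x'] := shape_inhabited hX'.
have [y] := shape_inhabited hY.
move=> /(bf_inward_limits x x').
have limE (S T : linorder) : ~ has_min S -> inward_limits S T = setT.
  by move=> mS; apply/seteqP; split=> z //; right.
rewrite !limE; [|by move/(shape_min hX')|by move/(shape_min hX)].
have -> : [set: Y] = [set y].
  by apply/seteqP; split=> z // _; exact: (shape_one hY).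
have [Z YZ [z _ _]] := shape_mul hY' v1 q1.
have [f fs fm] := iso_sym YZ.
apply: (@not_bf2_set1 _ _ _ _ (f (pt z 0)) (f (pt z 1))) => //.
by rewrite lt_eqF // fm lt_ptS.
Qed.

End Inward.

(** * Monomials *)

Section Monomials.
Implicit Types X Y Z : linorder.

(** Such a property of a monomial can be read off its factors; it will be non-emptiness or the
    existence of an endpoint. *)
Definition multiplicative (P : linorder -> Prop) :=
  P lin_one /\ forall X Y, P (lin_mul X Y) <-> P X /\ P Y.

Lemma multiplicative_inhabited : multiplicative (fun X => inhabited X).
Proof.
split=> [|X Y]; first by exists; exact: ord0.
by split=> [[[y x]]|[[x] [y]]]; [split; exists|exists; exact: (y, x)].
Qed.

Lemma multiplicative_has_min : multiplicative has_min.
Proof.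
split=> [|X Y]; first by exists ord0 => // i _; rewrite (ord1 i).
split=> [[[y x] _ h]|[[x _ xmin] [y _ ymin]]].
  split; [exists x => // z _|exists y => // z _].
    have := h (y, z) I; rewrite !leNgt lt_mul /=.
    by rewrite ltxx eqxx.
  have := h (z, x) I; rewrite !leNgt lt_mul /=.
  by rewrite negb_or => /andP[].
exists (y, x) => // -[z w] _; rewrite leNgt lt_mul /= negb_or negb_and -!leNgt.
by rewrite ymin //= xmin // orbT.
Qed.

Lemma multiplicative_has_max : multiplicative has_max.
Proof.
have [_ m] := multiplicative_has_min.
split=> [|X Y]; first by exists ord0 => // i _; rewrite (ord1 i).
apply: iff_trans (iff_sym (iso_has_min (iso_rev_mul X Y))) _.
exact: m (lin_rev X) (lin_rev Y).
Qed.

Lemma multiplicative_foldl P Y (s : seq linorder) : multiplicative P ->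
  P (foldl lin_mul Y s) <-> P Y /\ forall i, (i < size s)%N -> P (nth lin_one s i).
Proof.
move=> [_ PM]; elim: s Y => [|X s IHs] Y /=; first by split=> [|[]].
rewrite IHs PM; split=> [[[PY PX] Ps]|[PY Ps]].
  by split=> // -[|i] //; exact: Ps.
by split=> [|i si]; [split=> //; exact: (Ps 0%N isT)|exact: (Ps i.+1)].
Qed.

Lemma multiplicative_lin_pow P X n : multiplicative P -> n <> 0%N ->
  P (lin_pow X n) <-> P X.
Proof.
case: n => // n PM _; rewrite /lin_pow /= multiplicative_foldl //.
split=> [[]//|PX]; split=> // i; rewrite size_nseq nth_nseq => ->.
exact: PX.
Qed.

Lemma iso_foldl X Y s : iso X Y -> iso (foldl lin_mul X s) (foldl lin_mul Y s).
Proof.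
elim: s X Y => //= T s IHs X Y XY; apply: IHs.
exact: iso_mul XY (iso_refl T).
Qed.

Lemma iso_foldl_mul X Y s :
  iso (foldl lin_mul (lin_mul X Y) s) (lin_mul X (foldl lin_mul Y s)).
Proof.
elim: s Y => [|T s IHs] Y /=; first exact: iso_refl.
exact: iso_trans (iso_foldl _ (iso_mulA X Y T)) (IHs _).
Qed.

Lemma iso_foldl_cons X s :
  iso (foldl lin_mul X s) (lin_mul X (foldl lin_mul lin_one s)).
Proof. exact: iso_trans (iso_foldl _ (iso_mul1 X)) (iso_foldl_mul _ _ _). Qed.

(** What is left of the monomial once a first factor [M 0] is removed. Starting from [lin_one]
    covers the case in which nothing is left. *)
Definition cofactor (M : nat -> linorder) (m : nat -> nat) (s : nat) : linorder :=
  foldl lin_mul lin_one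
    (nseq (m 0%N).-1 (M 0%N) ++ [seq lin_pow (M i) (m i) | i <- iota 1 s.-1]).

Lemma iso_pow_prod M m s : s <> 0%N -> m 0%N <> 0%N ->
  iso (pow_prod M m s) (lin_mul (M 0%N) (cofactor M m s)).
Proof.
rewrite /pow_prod /cofactor; case: s => // s _; case m0E : (m 0%N) => [//|k] _ /=.
rewrite m0E /lin_pow /= -foldl_cat.
exact: iso_foldl_cons.
Qed.

(** The further factors [M 0] satisfy [P] by hypothesis, so only the later powers count. *)
Lemma multiplicative_cofactor P M m s : multiplicative P -> P (M 0%N) ->
  (forall i, (i < s)%N -> m i <> 0%N) ->
  P (cofactor M m s) <-> forall i, (0 < i < s)%N -> P (M i).
Proof.
move=> PM P0 m0; have [P1 _] := PM; rewrite /cofactor multiplicative_foldl //.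
have nthE i : (i < s.-1)%N ->
    nth lin_one (nseq (m 0%N).-1 (M 0%N) ++ [seq lin_pow (M i) (m i) | i <- iota 1 s.-1])
      ((m 0%N).-1 + i) = lin_pow (M i.+1) (m i.+1).
  move=> is'; rewrite nth_cat size_nseq ltnNge leq_addr /= addKn.
  by rewrite (nth_map 0%N) ?size_iota // nth_iota.
rewrite size_cat size_nseq size_map size_iota; split=> [[_ h] [//|i] /= is1|h].
  have is' : (i < s.-1)%N by case: (s) is1.
  have := h ((m 0%N).-1 + i)%N; rewrite ltn_add2l nthE // => /(_ is').
  by move/(multiplicative_lin_pow _ PM (m0 _ is1)).
split=> // i; have [ik _|ki] := ltnP i (m 0%N).-1.
  by rewrite nth_cat size_nseq ik nth_nseq ik.
rewrite -(subnKC ki) ltn_add2l => is'; rewrite nthE //.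
have is1 : ((i - (m 0%N).-1).+1 < s)%N by case: (s) is'.
by apply/(multiplicative_lin_pow _ PM (m0 _ is1)); exact: h.
Qed.

Lemma alternating1 M : alternating M ->
  (M 0%N = omega -> M 1%N = omega_star) /\ (M 0%N = omega_star -> M 1%N = omega).
Proof.
move=> [Mo Mn]; split=> M0; case: (Mo 1%N) => // M1;
  by case: (Mn 0%N); rewrite M0 M1.
Qed.

Lemma has_min_omega : has_min omega.
Proof. by exists 0%N. Qed.

Lemma not_has_max_omega : ~ has_max omega.
Proof. by move=> [n _ /(_ n.+1 I)]; rewrite leNgt ltEnat /= ltnSn. Qed.

Lemma has_max_omega_star : has_max omega_star.
Proof. exact: has_min_omega. Qed.

Lemma not_has_min_omega_star : ~ has_min omega_star.
Proof. exact: not_has_max_omega. Qed.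

Lemma iso_rev_omega_star : iso (lin_rev omega_star) omega.
Proof. by exists id => // x; exists x. Qed.

Lemma cofactor_single M m s : s = 1%N -> m 0%N = 1%N ->
  forall y z : cofactor M m s, y = z.
Proof.
by move=> -> m0; rewrite /cofactor m0 /= => y z; rewrite (ord1 y) (ord1 z).
Qed.

(** One more factor [M 0] can be split off; the remainder is a power of [M 0], possibly empty, and
    so satisfies [P]. *)
Lemma cofactor_mul (P : linorder -> Prop) M m s : multiplicative P -> P (M 0%N) ->
  s = 1%N -> (1 < m 0%N)%N ->
  exists2 Z, iso (cofactor M m s) (lin_mul (M 0%N) Z) & P Z.
Proof.
move=> PM P0 ->; rewrite /cofactor; case: (m 0%N) => [|[|k]] //= _.
exists (foldl lin_mul lin_one (nseq k (M 0%N) ++ [::])).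
  apply: iso_trans _ (iso_foldl_cons _ _).
  apply: iso_foldl; exists (fun a : lin_mul lin_one (M 0%N) => a.1).
  - by move=> y; exists (y, ord0).
  - by move=> [y i] [z j]; rewrite lt_mul /= (ord1 i) (ord1 j) ltxx andbF orbF.
have [P1 _] := PM; apply/multiplicative_foldl => //; split=> // i.
by rewrite cats0 size_nseq nth_nseq => ->.
Qed.

End Monomials.

(** * Monomials as multiples of $\omega$ or $\omega^*$, and criteria in terms of exponents *)

Section Shapes.
Implicit Types X Y Z : linorder.

(** In use, [P] is the existence of the endpoint that [M 0] has and [M 1] lacks, so a second power
    destroys it. *)
Lemma shape_cofactor (P : linorder -> Prop) M m s : alternating M ->
  multiplicative P -> P (M 0%N) -> ~ P (M 1%N) ->
  (0 < s)%N -> (forall i, (i < s)%N -> m i <> 0%N) ->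
  [/\ inhabited (cofactor M m s), P (cofactor M m s) <-> s = 1%N &
      iso (pow_prod M m s) (lin_mul (M 0%N) (cofactor M m s))].
Proof.
move=> [Mo _] PM P0 P1 s0 m0; split.
- have inh i : inhabited (M i) by case: (Mo i) => ->; exists; exact: 0%N.
  exact/(multiplicative_cofactor multiplicative_inhabited (inh 0%N) m0).
- rewrite multiplicative_cofactor //; split=> [h|-> [|i]//].
  by case: s s0 h {m0} => [|[|s]] // _ /(_ 1%N isT).
- by apply: iso_pow_prod; [case: (s) s0|exact: m0].
Qed.

Lemma pow_prod_omega M m s : alternating M -> M 0%N = omega ->
  (0 < s)%N -> (forall i, (i < s)%N -> m i <> 0%N) ->
  exists2 Y, iso (pow_prod M m s) (lin_mul omega Y) & cofactor_shape s (m 0%N) Y.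
Proof.
move=> aM M0 s0 m0; have M1 := (alternating1 aM).1 M0.
have P0 : has_min (M 0%N) by rewrite M0; exact: has_min_omega.
have P1 : ~ has_min (M 1%N) by rewrite M1; exact: not_has_min_omega_star.
have [inh mE MC] := shape_cofactor aM multiplicative_has_min P0 P1 s0 m0.
exists (cofactor M m s); first by rewrite -[X in lin_mul X _]M0.
split=> //; first exact: cofactor_single.
by have := cofactor_mul multiplicative_has_min P0; rewrite M0; exact.
Qed.

(** The cofactor is reversed, so that its greatest point becomes the least point of which
    [cofactor_shape] speaks; both values of [M 0] then share one record. *)
Lemma pow_prod_omega_star M m s : alternating M -> M 0%N = omega_star ->
  (0 < s)%N -> (forall i, (i < s)%N -> m i <> 0%N) ->
  exists2 Y, iso (pow_prod M m s) (lin_rev (lin_mul omega Y)) & cofactor_shape s (m 0%N) Y.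
Proof.
move=> aM M0 s0 m0; have M1 := (alternating1 aM).2 M0.
have P0 : has_max (M 0%N) by rewrite M0; exact: has_max_omega_star.
have P1 : ~ has_max (M 1%N) by rewrite M1; exact: not_has_max_omega.
have [inh mE MC] := shape_cofactor aM multiplicative_has_max P0 P1 s0 m0.
have C_single := @cofactor_single M m s.
have C_mul := cofactor_mul multiplicative_has_max P0.
move: MC C_mul; rewrite M0 => MC C_mul.
have revE C : iso (lin_rev (lin_mul omega_star C)) (lin_mul omega (lin_rev C)).
  apply: iso_trans (iso_sym (iso_rev_mul _ _)) _.
  exact: iso_mul iso_rev_omega_star (iso_refl _).
exists (lin_rev (cofactor M m s)).
  apply: iso_trans MC _; apply: iso_trans (iso_sym (iso_rev_rev _)) _.
  exact: iso_rev (revE _).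
split=> // s1 m1; have [Z CZ maxZ] := C_mul m s s1 m1.
exists (lin_rev Z); last exact: maxZ.
exact: iso_trans (iso_rev CZ) (revE Z).
Qed.

Lemma iso_bf_equiv n X X' Y Y' :
  iso X X' -> iso Y Y' -> bf_equiv n X Y <-> bf_equiv n X' Y'.
Proof.
move=> XX' YY'; split=> e.
  apply: bf_equiv_trans (bf_equiv_sym (iso_equiv n XX')) _.
  exact: bf_equiv_trans e (iso_equiv n YY').
apply: bf_equiv_trans (iso_equiv n XX') _.
exact: bf_equiv_trans e (bf_equiv_sym (iso_equiv n YY')).
Qed.

(** The obstructions visible in the limits of the second summand, up to exchanging the two sums;
    those of the first summand follow by reversal. *)
Lemma not_bf4_inward X Y X' Y' s t n m u v p q :
  cofactor_shape s m X -> cofactor_shape t n Y -> cofactor_shape u p X' -> cofactor_shape v q Y' ->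
  n <> 0%N -> q <> 0%N ->
  (t = 1%N /\ v <> 1%N /\ (s <> 1%N \/ n <> 1%N)) \/
  (v = 1%N /\ t <> 1%N /\ (u <> 1%N \/ q <> 1%N)) \/
  (s <> 1%N /\ u <> 1%N /\ t = 1%N /\ v = 1%N /\
    ((n = 1%N /\ (1 < q)%N) \/ (q = 1%N /\ (1 < n)%N))) ->
  ~ bf_equiv 4 (inward X Y) (inward X' Y').
Proof.
move=> hX hY hX' hY' n0 q0.
case=> [[t1 [v1 c]]|[[v1 [t1 c]]|[s1 [u1 [t1 [v1 [[n1 q1]|[q1 n1]]]]]]]].
- exact: not_bf4_inward_min hX hY hX' hY' n0 q0 t1 v1 c.
- move=> /bf_equiv_sym.
  exact: not_bf4_inward_min hX' hY' hX hY q0 n0 v1 t1 c.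
- exact: not_bf4_inward_one hX hY hX' hY' s1 u1 t1 v1 n1 q1.
- move=> /bf_equiv_sym.
  exact: not_bf4_inward_one hX' hY' hX hY u1 s1 v1 t1 q1 n1.
Qed.

(** Only the existence of limits and of limits of the reverse order counts here, and each triple
    describes a sum without them. *)
Lemma bf_equiv3_inward_iff X Y X' Y' s t n m u v p q :
  cofactor_shape s m X -> cofactor_shape t n Y -> cofactor_shape u p X' -> cofactor_shape v q Y' ->
  n <> 0%N -> q <> 0%N -> m <> 0%N -> p <> 0%N ->
  bf_equiv 3 (inward X Y) (inward X' Y') <->
  ([/\ s = 1%N, t = 1%N & n = 1%N] <-> [/\ u = 1%N, v = 1%N & q = 1%N]) /\
  ([/\ t = 1%N, s = 1%N & m = 1%N] <-> [/\ v = 1%N, u = 1%N & p = 1%N]).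
Proof.
move=> hX hY hX' hY' n0 q0 m0 p0.
have [x] := shape_inhabited hX; have [x'] := shape_inhabited hX'.
have [y] := shape_inhabited hY; have [y'] := shape_inhabited hY'.
have L1 := inward_limits_nonempty hX hY n0.
have L2 := inward_limits_nonempty hX' hY' q0.
have L3 := inward_limits_nonempty hY hX m0.
have L4 := inward_limits_nonempty hY' hX' p0.
have notE P Q : (~ P <-> ~ Q) -> (P <-> Q).
  by move=> [PQ QP]; split=> h; apply: contrapT => /[dup]; [move/QP|move/PQ].
split=> [e|[c1 c2]].
  have /bf1P b := bf_inward_limits x x' e.
  have /bf1P c := bf_inward_limits y y' (bf_equiv_inward_swap e).
  move: b c; rewrite L1 L2 L3 L4 => c1 c2.
  by split; exact: notE.
by apply: bf_equiv3_inward => //; rewrite ?L1 ?L2 ?L3 ?L4 ?c1 ?c2.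
Qed.

End Shapes.

(* Arithmetic of the exceptional cases, and the theorem *)
Local Close Scope order_scope.
Local Close Scope classical_set_scope.

(** Outside the exceptions there remains what [bf_equiv_inward_r] asks for, for either summand,
    apart from the alternatives [m = p] and [n = q], which serve for summands that coincide. *)
Lemma exceptional_cases s t u v m n p q :
  0 < s -> 0 < t -> 0 < u -> 0 < v -> m <> 0 -> n <> 0 -> p <> 0 -> q <> 0 ->
  ~ exceptional3 s t u v m n p q -> ~ exceptional2 s t u v m n p q ->
  [/\ s = 1 <-> u = 1, t = 1 <-> v = 1,
      t = 1 \/ s <> 1 \/ m = p \/ m <> 1 /\ p <> 1 &
      s = 1 \/ t <> 1 \/ n = q \/ n <> 1 /\ q <> 1].
Proof.
rewrite /exceptional3 /exceptional2 => s0 t0 u0 v0 m0 n0 p0 q0.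
move=> /not_orP[ea /not_orP[eb /not_orP[ec /not_orP[ed /not_orP[ee ef]]]]].
move=> /not_orP[eg /not_orP[eh /not_orP[ei ej]]].
have su : s = 1 <-> u = 1.
  split=> [s1|u1]; apply: contrapT => ne.
  (* If just one of [s] and [u] is 1, a clause for 2 or one for 3 applies, according to [t] and the
     exponents. *)
  - have [h|h] : t = 1 /\ minn m n = 1 \/ (2 <= t \/ t = 1 /\ 2 <= minn m n) by lia.
      by apply: eg; case: h; split=> //; lia.
    by apply: ec; split=> //; lia.
  - have [h|h] : v = 1 /\ minn p q = 1 \/ (2 <= v \/ v = 1 /\ 2 <= minn p q) by lia.
      by apply: eh; case: h; split=> //; lia.
    by apply: ed; split=> //; lia.
have tv : t = 1 <-> v = 1.
  split=> [t1|v1]; apply: contrapT => ne.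
  - have [h|h] : s = 1 /\ minn m n = 1 \/ (2 <= s \/ s = 1 /\ 2 <= minn m n) by lia.
      by apply: ei; case: h; split=> //; lia.
    by apply: ee; split=> //; lia.
  - have [h|h] : u = 1 /\ minn p q = 1 \/ (2 <= u \/ u = 1 /\ 2 <= minn p q) by lia.
      by apply: ej; case: h; split=> //; lia.
    by apply: ef; split=> //; lia.
split=> //.
- apply: contrapT => h; apply: ea; split; lia.
- apply: contrapT => h; apply: eb; split; lia.
Qed.

Theorem theorem4p6 (M N : nat -> linorder) (s t u v : nat)
    (m n p q : nat -> nat)
    (altM : alternating M) (altN : alternating N)
    (M0N0 : M 0 = omega <-> N 0 = omega_star)
    (s_ge1 : 1 <= s) (t_ge1 : 1 <= t) (u_ge1 : 1 <= u) (v_ge1 : 1 <= v)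
    (m_neq0 : forall i, i < s -> m i <> 0)
    (n_neq0 : forall i, i < t -> n i <> 0)
    (p_neq0 : forall i, i < u -> p i <> 0)
    (q_neq0 : forall i, i < v -> q i <> 0) :
  let A1 := pow_prod M m s in
  let A2 := pow_prod N n t in
  let B1 := pow_prod M p u in
  let B2 := pow_prod N q v in
  let A := lin_add A1 A2 in
  let B := lin_add B1 B2 in
  let exc3 := M 0 = omega_star /\
    exceptional3 s t u v (m 0) (n 0) (p 0) (q 0) in
  let exc2 := M 0 = omega_star /\
    exceptional2 s t u v (m 0) (n 0) (p 0) (q 0) in
  [/\ (~ exc3 -> ~ exc2 ->
         ef_length A B = ext_min (ef_length A1 B1) (ef_length A2 B2)),
      (exc3 -> ef_length A B = Some 3) &
      (exc2 -> ef_length A B = Some 2)].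
Proof.
move=> A1 A2 B1 B2 A B exc3 exc2.
have inh (T : linorder) Y : iso T (lin_mul omega Y) -> inhabited Y -> inhabited T.
  by move=> [f fs _] [y]; have [z _] := fs (pt y 0); exists.
have inhr (T : linorder) Y :
    iso T (lin_rev (lin_mul omega Y)) -> inhabited Y -> inhabited T.
  by move=> [f fs _] [y]; have [z _] := fs (pt y 0); exists.
have [[M0|M0] neqM] := (altM.1 0%N, altM.2 0%N).
  (* With $\omega$ first there are no exceptions: the sum determines its first summand and, by
     reversal, its second. *)
  have N0 := M0N0.1 M0.
  (* The two orders differ because [M] alternates: [M 1] is [omega_star] and is not [M 0]. *)
  have M0' : M 0%N <> omega_star by rewrite -((alternating1 altM).1 M0) => /esym.
  have [X A1X hX] := pow_prod_omega altM M0 s_ge1 m_neq0.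
  have [X' B1X' hX'] := pow_prod_omega altM M0 u_ge1 p_neq0.
  have [Y A2Y hY] := pow_prod_omega_star altN N0 t_ge1 n_neq0.
  have [Y' B2Y' hY'] := pow_prod_omega_star altN N0 v_ge1 q_neq0.
  have [x] := shape_inhabited hX; have [x'] := shape_inhabited hX'.
  have [y] := shape_inhabited hY; have [y'] := shape_inhabited hY'.
  have [a1] := inh _ _ A1X (inhabits x); have [b1] := inh _ _ B1X' (inhabits x').
  have [a2] := inhr _ _ A2Y (inhabits y); have [b2] := inhr _ _ B2Y' (inhabits y').
  split=> [_ _|[]//|[]//].
  apply: (ef_length_min (inl a1 : A) (inl b1 : B) a1 b1 a2 b2) => k.
  split=> [|[]]; last exact: bf_equiv_add.
  move/(iso_bf_equiv k (iso_add A1X A2Y) (iso_add B1X' B2Y')) => e.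
  split; first exact/(iso_bf_equiv k A1X B1X')/(bf_equiv_outward_l x x' e).
  apply/(iso_bf_equiv k A2Y B2Y')/bf_equiv_rev.
  exact: (bf_equiv_outward_l y y' (bf_equiv_outward_swap e)).
(* If [N 0] were [omega_star], then [M 0] would be both orders, and [M 1] would equal [M 0]. *)
have N0 : N 0%N = omega.
  case: (altN.1 0%N) => // /M0N0 M0'.
  by case: neqM; rewrite M0 ((alternating1 altM).1 M0').
have [X A1X hX] := pow_prod_omega_star altM M0 s_ge1 m_neq0.
have [X' B1X' hX'] := pow_prod_omega_star altM M0 u_ge1 p_neq0.
have [Y A2Y hY] := pow_prod_omega altN N0 t_ge1 n_neq0.
have [Y' B2Y' hY'] := pow_prod_omega altN N0 v_ge1 q_neq0.
have [x] := shape_inhabited hX; have [x'] := shape_inhabited hX'.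
have [y] := shape_inhabited hY; have [y'] := shape_inhabited hY'.
have [a1] := inhr _ _ A1X (inhabits x); have [b1] := inhr _ _ B1X' (inhabits x').
have [a2] := inh _ _ A2Y (inhabits y); have [b2] := inh _ _ B2Y' (inhabits y').
have ABE k := iso_bf_equiv k (iso_add A1X A2Y) (iso_add B1X' B2Y').
have m0 := m_neq0 0%N s_ge1; have n0 := n_neq0 0%N t_ge1.
have p0 := p_neq0 0%N u_ge1; have q0 := q_neq0 0%N v_ge1.
have e3 := bf_equiv3_inward_iff hX hY hX' hY' n0 q0 m0 p0.
split=> [nexc3 nexc2|[_ exc]|[_ exc]].
- have {}nexc3 : ~ exceptional3 s t u v (m 0%N) (n 0%N) (p 0%N) (q 0%N).
    by move=> ?; exact: nexc3.
  have {}nexc2 : ~ exceptional2 s t u v (m 0%N) (n 0%N) (p 0%N) (q 0%N).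
    by move=> ?; exact: nexc2.
  have [su tv c1 c2] :=
    exceptional_cases s_ge1 t_ge1 u_ge1 v_ge1 m0 n0 p0 q0 nexc3 nexc2.
  (* This settles the alternatives [m 0 = p 0] and [n 0 = q 0] for single powers: the summands are
     then the same order. *)
  have pow1 (K : nat -> linorder) e e' j j' : j = 1%N -> j' = 1%N ->
      e 0%N = e' 0%N -> pow_prod K e j = pow_prod K e' j'.
    by move=> -> -> ee'; rewrite /pow_prod /= ee'.
  apply: (ef_length_min (inl a1 : A) (inl b1 : B) a1 b1 a2 b2) => k.
  split=> [|[]]; last exact: bf_equiv_add.
  move/ABE => e; split.
  + have [[s1 mp]|c1'] : (s = 1%N /\ m 0%N = p 0%N) \/
        (t = 1%N \/ s <> 1%N \/ (m 0%N <> 1%N /\ p 0%N <> 1%N)).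
      by move: c1; lia.
      rewrite /A1 /B1 (pow1 M m p s u s1 (su.1 s1) mp).
      exact: bf_refl.
    apply/(iso_bf_equiv k A1X B1X')/bf_equiv_rev.
    exact: bf_equiv_inward_r hY hX hY' hX' m0 p0 tv su c1' (bf_equiv_inward_swap e).
  + have [[t1 nq]|c2'] : (t = 1%N /\ n 0%N = q 0%N) \/
        (s = 1%N \/ t <> 1%N \/ (n 0%N <> 1%N /\ q 0%N <> 1%N)).
      by move: c2; lia.
      rewrite /A2 /B2 (pow1 N n q t v t1 (tv.1 t1) nq).
      exact: bf_refl.
    apply/(iso_bf_equiv k A2Y B2Y').
    exact: bf_equiv_inward_r hX hY hX' hY' n0 q0 su tv c2' e.
- apply: (ef_length_Some (inl a1 : A) (inl b1 : B)).
    (* In each clause for 3, all four triples compared by [e3] are false. *)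
    apply/ABE/e3; case: exc => [[[s1 u1] [t2 v2] mp mp']|[[[s1 u1] [t2 v2] mp mp']|]].
    + by split; split=> -[]; lia.
    + by split; split=> -[]; lia.
    + by case=> [|[|[|]]] [h1 h2 h3]; split; split=> -[]; lia.
  move/ABE => e.
  (* Level 4 fails because of the limits of the sums or, in the second half of the disjunction,
     because of those of the reversed sums. *)
  have D : ((t = 1%N /\ v <> 1%N /\ (s <> 1%N \/ n 0%N <> 1%N)) \/
      (v = 1%N /\ t <> 1%N /\ (u <> 1%N \/ q 0%N <> 1%N)) \/
      (s <> 1%N /\ u <> 1%N /\ t = 1%N /\ v = 1%N /\
        ((n 0%N = 1%N /\ (1 < q 0)%N) \/ (q 0%N = 1%N /\ (1 < n 0)%N)))) \/
    ((s = 1%N /\ u <> 1%N /\ (t <> 1%N \/ m 0%N <> 1%N)) \/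
      (u = 1%N /\ s <> 1%N /\ (v <> 1%N \/ p 0%N <> 1%N)) \/
      (t <> 1%N /\ v <> 1%N /\ s = 1%N /\ u = 1%N /\
        ((m 0%N = 1%N /\ (1 < p 0)%N) \/ (p 0%N = 1%N /\ (1 < m 0)%N)))).
    case: exc => [[[s1 u1] [t2 v2] mp mp']|[[[s1 u1] [t2 v2] mp mp']|]].
    + by right; do 2!right; lia.
    + by left; do 2!right; lia.
    + case=> [|[|[|]]] [h1 h2 h3].
      * by right; left; lia.
      * by right; right; left; lia.
      * by left; left; lia.
      * by left; right; left; lia.
  case: D => D; first exact: not_bf4_inward hX hY hX' hY' n0 q0 D e.
  exact: not_bf4_inward hY hX hY' hX' m0 p0 D (bf_equiv_inward_swap e).
- apply: (ef_length_Some (inl a1 : A) (inl b1 : B)).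
    exact/ABE/bf_equiv2_inward.
  (* In each clause for 2, the exponent equal to 1 makes one side of an equivalence in [e3] true,
     while a number of powers that is at least 2 makes the other side false. *)
  move=> /ABE/e3[[i1 i2] [i3 i4]].
  case: exc => [|[|[|]]] [h1 h2 h3 h4].
  + have [e|e] : m 0%N = 1%N \/ n 0%N = 1%N by lia.
      by have [] := i3 (And3 h3 h1 e); lia.
    by have [] := i1 (And3 h1 h3 e); lia.
  + have [e|e] : p 0%N = 1%N \/ q 0%N = 1%N by lia.
      by have [] := i4 (And3 h3 h1 e); lia.
    by have [] := i2 (And3 h1 h3 e); lia.
  + have [e|e] : m 0%N = 1%N \/ n 0%N = 1%N by lia.
      by have [] := i3 (And3 h1 h3 e); lia.
    by have [] := i1 (And3 h3 h1 e); lia.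
  + have [e|e] : p 0%N = 1%N \/ q 0%N = 1%N by lia.
      by have [] := i4 (And3 h1 h3 e); lia.
    by have [] := i2 (And3 h3 h1 e); lia.
Qed.
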